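(* Consider all families $\mathbf g$ as described in the context, satisfying the nondegeneracy condition. Then distinct such families give distinct sets $C(\mathbf g)$, and the number $\tilde K_{LA}(n)$ of distinct sets $C(\mathbf g)$ equals $$|\mathcal D^{m-1}|\prod_{t=1}^{m-2}\left(|\mathcal D^t|^{|V^{t+1}|}-|\mathcal D^t|\cdot|V^{t+1}|\right)^{|V^{t+2}|\cdots|V^{m-1}|} =\frac{n!}{6\left(\left(\frac n4\right)!\right)^4}\prod_{k=2,4,\dots,\frac n4}\left(\left(2\cdot 2^{-\frac nk}\binom{k}{k/2}^{\frac nk}\right)^{2^{\frac n{2k}-1}}-\binom{k}{k/2}^{\frac nk}2^{-\frac n{2k}}\right)^{2^{\frac n{2k}-\log_2\frac n{2k}-1}},$$ and, as $m\to\infty$, $$\tilde K_{LA}(n)\sim|\mathcal D^{m-1}|\prod_{t=1}^{m-2}|\mathcal D^t|^{|V^{t+1}|\cdot|V^{t+2}|\cdots|V^{m-1}|}=\frac{n!}{6\left(\left(\frac n4\right)!\right)^4}\prod_{k=2,4,\dots,\frac n4}\left(2\cdot 2^{-\frac nk}\binom{k}{k/2}^{\frac nk}\right)^{2^{\frac nk-\log_2\frac nk-1}} .$$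
   Context: Fix an integer $m\ge 4$ and $n=2^m$. $F^n$ is the set of binary words of length $n$ with Hamming distance $d$ and coordinatewise addition mod 2; $F^n_{Ev}$ is the set of words of even weight. For $\bar x\in F^n$ let $\Omega(\bar x)=\{\bar y: d(\bar y,\bar x)=1\}$, and $\Omega(S)=\bigcup_{\bar x\in S}\Omega(\bar x)$ for $S\subseteq F^n$. For $t=1,\dots,m-1$ let $V^t=\{(\bar v,\bar v,0,\dots,0)\in F^n:\bar v\in F^{2^{m-t}}_{Ev}\}$ ($\bar v$ in the first $2^{m-t}$ coordinates, a copy in the next $2^{m-t}$, zeros elsewhere). Let $A^1=V^1$ and $A^t=V^t+A^{t-1}=\{\bar r+\bar a:\bar r\in V^t,\bar a\in A^{t-1}\}$ for $t=2,\dots,m-1$. Every isometry of $F^n$ has a unique form $\bar x\mapsto\bar v+\pi(\bar x)$ ($\bar v\in F^n$, $\pi$ a coordinate permutation); it is a translation if $\pi=\mathrm{id}$. For $S\subseteq F^n$, $\mathrm{Aut}(S)$ is the group of isometries $g$ with $g(S)=S$; for a collection $\mathbf S$ of subsets, $\mathrm{Aut}(\mathbf S)$ is the group of isometries mapping each member of $\mathbf S$ to a member of $\mathbf S$. Put $\mathcal A^t=\mathrm{Aut}(\Omega(A^t))$, $\mathcal B^1=\mathrm{Aut}(A^1)$, $\mathcal B^t=\mathrm{Aut}(\{\bar r+\Omega(A^{t-1})\}_{\bar r\in V^t})$ for $t\ge2$. For each $t=1,\dots,m-1$, $\mathcal D^t$ is a fixed set containing exactly one element of each left coset $g\mathcal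 B^t$ ($g\in\mathcal A^t$), chosen so that whenever cosets $D_1,D_2$ with representatives $d_1,d_2\in\mathcal D^t$ satisfy $D_1=\tau D_2$ for a translation $\tau$, then $d_1=\tau d_2$. A collection $\{g_{\bar r}\}_{\bar r\in L}$ of isometries $g_{\bar r}(\cdot)=\bar v_{\bar r}+\pi_{\bar r}(\cdot)$ indexed by a linear subspace $L$ is degenerate if $\pi_{\bar r}$ does not depend on $\bar r$ and $\{\bar r+\bar v_{\bar r}:\bar r\in L\}$ is an affine subspace of $F^n$; otherwise nondegenerate. A family $\mathbf g$ consists of, for every $t\in\{2,\dots,m\}$ and every tuple $(\bar r_t,\dots,\bar r_{m-1})\in V^t\times\dots\times V^{m-1}$, an element $g_{\bar r_t,\dots,\bar r_{m-1}}\in\mathcal D^{t-1}$ (for $t=m$ the tuple is empty, giving a single $g\in\mathcal D^{m-1}$), such that for every $t\in\{2,\dots,m-1\}$ and every $(\bar r_{t+1},\dots,\bar r_{m-1})$ the collection $\{g_{\bar r_t,\dots,\bar r_{m-1}}\}_{\bar r_t\in V^t}$ is nondegenerate. From $\mathbf g$ define $A^1_{\bar r_2,\dots,\bar r_{m-1}}=V^1$, $A^t_{\bar r_{t+1},\dots,\bar r_{m-1}}=\bigcup_{\bar r_t\in V^t}\big(\bar r_t+g_{\bar r_t,\dots,\bar r_{m-1}}(A^{t-1}_{\bar r_t,\dots,\bar r_{m-1}})\big)$ for $t=2,\dots,m-1$ (so $A^{m-1}$ with empty index is obtained), and $C(\mathbf g)=g(A^{m-1})$. In the formulas, $k=2^t$.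 *)

(* Defs.v *)
From mathcomp Require Import all_boot all_order all_algebra all_fingroup.
From mathcomp Require Import boolp reals.

Set Implicit Arguments.
Unset Strict Implicit.
Unset Printing Implicit Defensive.

Import GRing.Theory.

Local Open Scope ring_scope.

Notation word n := 'rV['F_2]_n.

Definition hdist n (x y : word n) : nat := #|[set i | x 0 i != y 0 i]|.

Definition even_word n (x : word n) : bool := ~~ odd (hdist x 0).

Definition Omega n (S : {set word n}) : {set word n} :=
  \bigcup_(x in S) [set y | hdist y x == 1%N].

Definition translate n (r : word n) (S : {set word n}) : {set word n} :=
  [set r + x | x in S].

Definition isometries n : {set {perm word n}} :=
  [set g : {perm word n} | [forall x, forall y, hdist (g x) (g y) == hdist x y]].

(* [col_perm p x] is the word [x] with its coordinates permuted by [p]. *)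
Definition isometry_form n (g : {perm word n}) (v : word n) (p : 'S_n) : Prop :=
  forall x, g x = v + col_perm p x.

Definition is_translation n (g : {perm word n}) : Prop :=
  exists v : word n, isometry_form g v 1%g.

Definition Aut_set n (S : {set word n}) : {set {perm word n}} :=
  [set g in isometries n | g @: S == S].

Definition Aut_coll n (SS : {set {set word n}}) : {set {perm word n}} :=
  [set g in isometries n | [forall S in SS, g @: S \in SS]].

Definition is_affine n (S : {set word n}) : Prop :=
  exists (a : word n) (L : {vspace word n}), S = [set x | x - a \in L].

Definition degenerate n (L : {set word n}) (g : word n -> {perm word n}) : Prop :=
  exists (p : 'S_n) (v : word n -> word n),
    (forall r, r \in L -> isometry_form (g r) (v r) p) /\
    is_affine [set r + v r | r in L].

(* The concatenation has length 2 * 2 ^ (m - t), and the indexing of a sequence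
   returns 0 out of bounds: this is the word (v, v, 0, ..., 0). *)
Definition twice m t (v : word (2 ^ (m - t))) : word (2 ^ m) :=
  let s := [seq v 0 j | j <- enum 'I_(2 ^ (m - t))] in \row_i (s ++ s)`_i.

Definition V (m t : nat) : {set word (2 ^ m)} :=
  [set @twice m t v | v in [set v | even_word v]].

(* Only the values at t >= 1 are meaningful. *)
Fixpoint A (m t : nat) : {set word (2 ^ m)} :=
  match t with
  | 0 => set0
  | 1 => V m 1
  | t'.+1 => [set r + a | r in V m t, a in A m t']
  end.

Definition calA (m t : nat) : {set {perm word (2 ^ m)}} := Aut_set (Omega (A m t)).

Definition calB (m t : nat) : {set {perm word (2 ^ m)}} :=
  if t == 1%N then Aut_set (A m 1)
  else Aut_coll [set translate r (Omega (A m t.-1)) | r in V m t].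

(* The product [s * t] of permutations maps [x] to [t (s x)], so that the set
   {g o b : b in B} (the left coset gB for the composition of maps) is
   [B :* g], and the set {tau o d : d in D} is [D :* tau].

   If D1 = tau D2, then also D1 = tau' D2 for every translation tau' = tau sigma
   with sigma in the stabilizer of D2, and this stabilizer contains nontrivial
   translations.  Hence d1 = tau d2 can only be required for one of
   the translations tau with D1 = tau D2. *)
Definition representatives m (D : nat -> {set {perm word (2 ^ m)}}) : Prop :=
  forall t, (1 <= t <= m.-1)%N ->
  [/\ D t \subset calA m t,
      forall g, g \in calA m t -> #|D t :&: (calB m t :* g)%g| = 1%N &
      forall d1 d2, d1 \in D t -> d2 \in D t ->
        (exists2 tau, is_translation tau &
           calB m t :* d1 = (calB m t :* d2) :* tau)%g ->
        (exists tau, [/\ is_translation tau,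
           calB m t :* d1 = (calB m t :* d2) :* tau & d1 = d2 * tau])%g].

(* The tuples (r_t, ..., r_(m-1)) of V^t x ... x V^(m-1); a tuple is
   represented by a sequence, whose length m - t determines t. *)
Definition is_index m t (rs : seq (word (2 ^ m))) : bool :=
  (size rs == m - t)%N && all (fun i => rs`_i \in V m (t + i)) (iota 0 (m - t)).

Definition is_family m (D : nat -> {set {perm word (2 ^ m)}})
    (g : seq (word (2 ^ m)) -> {perm word (2 ^ m)}) : Prop :=
  (forall t rs, (2 <= t <= m)%N -> is_index t rs -> g rs \in D t.-1) /\
  (forall t rs, (2 <= t <= m.-1)%N -> is_index t.+1 rs ->
     ~ degenerate (V m t) (fun r => g (r :: rs))).

(* Only the values at t >= 1 are meaningful; [rs] stands for
   (r_(t+1), ..., r_(m-1)). *)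
Fixpoint A_family m (g : seq (word (2 ^ m)) -> {perm word (2 ^ m)}) t rs
    : {set word (2 ^ m)} :=
  match t with
  | 0 => set0
  | 1 => V m 1
  | t'.+1 =>
      \bigcup_(r in V m t) translate r (g (r :: rs) @: A_family g t' (r :: rs))
  end.

Definition C m (g : seq (word (2 ^ m)) -> {perm word (2 ^ m)}) :
    {set word (2 ^ m)} :=
  g [::] @: A_family g m.-1 [::].

Definition K_LA m (D : nat -> {set {perm word (2 ^ m)}}) : nat :=
  #|[set S : {set word (2 ^ m)} | `[< exists2 g, is_family D g & S = C g >]]|.

Section Formulas.
Variables (R : realType) (m : nat) (D : nat -> {set {perm word (2 ^ m)}}).

Definition count_product : R :=
  #|D m.-1|%:R *
  \prod_(1 <= t < m.-1)
    (#|D t|%:R ^+ #|V m t.+1| - #|D t|%:R * #|V m t.+1|%:R)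
      ^+ (\prod_(t.+2 <= s < m) #|V m s|).

Definition main_product : R :=
  #|D m.-1|%:R *
  \prod_(1 <= t < m.-1) #|D t|%:R ^+ (\prod_(t.+1 <= s < m) #|V m s|).

(* In the closed forms n = 2 ^ m and the factor of index t is the one of
   k = 2 ^ t, for k = 2, 4, ..., n / 4; all the divisions in the exponents are
   exact, and [trunc_log 2] is only applied to powers of 2. *)
Definition count_closed : R :=
  let n := (2 ^ m)%N in
  n`!%:R / (6 * ((n %/ 4)`!)%:R ^+ 4) *
  \prod_(1 <= t < m.-1)
    let k := (2 ^ t)%N in
    let b : R := 'C(k, k %/ 2)%:R ^+ (n %/ k) in
    ((2 * 2 ^- (n %/ k) * b) ^+ (2 ^ (n %/ (2 * k) - 1))
     - b * 2 ^- (n %/ (2 * k)))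
      ^+ (2 ^ (n %/ (2 * k) - trunc_log 2 (n %/ (2 * k)) - 1)).

Definition main_closed : R :=
  let n := (2 ^ m)%N in
  n`!%:R / (6 * ((n %/ 4)`!)%:R ^+ 4) *
  \prod_(1 <= t < m.-1)
    let k := (2 ^ t)%N in
    let b : R := 'C(k, k %/ 2)%:R ^+ (n %/ k) in
    (2 * 2 ^- (n %/ k) * b)
      ^+ (2 ^ (n %/ k - trunc_log 2 (n %/ k) - 1)).

End Formulas.
Arguments count_product R {m} D.
Arguments main_product R {m} D.

(* Main.v *)
Require Import Defs.
From mathcomp Require Import all_boot all_order all_algebra all_fingroup.
From mathcomp Require Import boolp reals.
From mathcomp Require Import zify ring lra.

(** For [N = 2 ^ (m - t)] let [K t] be the space of the words whose coordinates
    in each residue class modulo [N] sum to zero, and let [hw t] be the half of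
    the coordinates that splits every residue class modulo [N] into two classes
    modulo [2 N].  Put [U t = V t + K (t - 1)]: this is the hyperplane of [K t]
    orthogonal to [hw t].  Then [Omega (A t) = Omega (U t) = Omega (K t)], so
    that the group [A^t] of the paper is [Aut (K t)] for [t <= m - 2] (and the
    group of the even words for [t = m - 1]), and [B^t] is [Aut (U t)].

    The key fact is that every linear functional that is constant on a code
    [S] of level [t] vanishes on [U t].  Indeed, if [a] is constant on the
    union of the [r + g_r (S_r)], then by induction [a] is constant on each
    [g_r (U (t - 1))].  Either [a] vanishes on [K (t - 1)], and we are done, or
    the direction of [g_r (U (t - 1))] is the kernel of [a] on [K (t - 1)] for
    all [r]; then all [g_r] have the same permutation part, and their
    translation part depends only on the value of [a] at [r], which makes the
    collection degenerate.  Since [U t] is its own double annihilator, [d (S)]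
    determines [d (U t)], hence the coset of [d]; the families are thus
    recovered from the top level down, and the number of codes is a product.

    A representative of level [t <= m - 2] has exactly one companion with the
    same permutation part, so a degenerate collection amounts to a
    representative and a linear functional on [V (t + 1)].  The number of
    representatives is an index of two groups whose permutation parts are
    (iterated) wreath products of symmetric groups. *)

Set Implicit Arguments.
Unset Strict Implicit.
Unset Printing Implicit Defensive.

Import Order.TTheory GRing.Theory Num.Theory.

Local Open Scope ring_scope.

(** * Words and isometries *)

Lemma F2_cases (a : 'F_2) : a = 0 \/ a = 1.
Proof. by case: a => [[|[|k]] h]; [left | right | ] => //; apply/val_inj. Qed.

Lemma F2_addxx (a : 'F_2) : a + a = 0.
Proof. by case: (F2_cases a) => ->; apply/val_inj. Qed.

Lemma F2_neq0 (a : 'F_2) : a != 0 -> a = 1.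
Proof. by case: (F2_cases a) => -> //; rewrite eqxx. Qed.

Section Words.
Variable n : nat.
Implicit Types (x y z r v a : word n) (S T L U : {set word n}) (p q : 'S_n)
  (g h d : {perm word n}).

Lemma word_addxx x : x + x = 0.
Proof. by apply/rowP => i; rewrite !mxE F2_addxx. Qed.

Lemma word_oppr x : - x = x.
Proof. by apply/eqP; rewrite -subr_eq0 -opprD word_addxx oppr0. Qed.

Lemma word_addKx x y : x + (x + y) = y.
Proof. by rewrite addrA word_addxx add0r. Qed.

Lemma word_addxK x y : y + x + x = y.
Proof. by rewrite -addrA word_addxx addr0. Qed.

Lemma word_add_eq x y z : (x + y == z) = (x == z + y).
Proof. by apply/eqP/eqP => [<-|->]; rewrite word_addxK. Qed.

Lemma word_eq_add x y : (x + y == 0) = (x == y).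
Proof. by rewrite word_add_eq add0r. Qed.

Definition unitw (i : 'I_n) : word n := delta_mx 0 i.

Lemma unitwE i j : unitw i 0 j = (i == j)%:R.
Proof. by rewrite mxE eqxx /= eq_sym. Qed.

Definition dot a x : 'F_2 := \sum_i a 0 i * x 0 i.

Lemma dotC a x : dot a x = dot x a.
Proof. by apply: eq_bigr => i _; rewrite mulrC. Qed.

Lemma dotDr a x y : dot a (x + y) = dot a x + dot a y.
Proof. by rewrite -big_split; apply: eq_bigr => i _; rewrite mxE mulrDr. Qed.

Lemma dot0r a : dot a 0 = 0.
Proof. by apply: big1 => i _; rewrite mxE mulr0. Qed.

Lemma dot_col_perm a p x : dot a (col_perm p x) = dot (col_perm p^-1 a) x.
Proof.
rewrite /dot (reindex_inj (@perm_inj _ p^-1)).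
by apply: eq_bigr => i _; rewrite !mxE permKV.
Qed.

Lemma col_permD p x y : col_perm p (x + y) = col_perm p x + col_perm p y.
Proof. by apply/rowP => i; rewrite !mxE. Qed.

Lemma col_perm0 p : col_perm p (0 : word n) = 0.
Proof. by apply/rowP => i; rewrite !mxE. Qed.

Lemma col_permKV p x : col_perm p (col_perm p^-1 x) = x.
Proof. by apply/rowP => i; rewrite !mxE permK. Qed.

Lemma col_permK p x : col_perm p^-1 (col_perm p x) = x.
Proof. by apply/rowP => i; rewrite !mxE permKV. Qed.

Lemma col_perm_inj p : injective (fun x => col_perm p x).
Proof. exact: can_inj (col_permK p). Qed.

Lemma col_perm_unitw p i : col_perm p (unitw (p i)) = unitw i.
Proof. by apply/rowP => j; rewrite mxE !unitwE (inj_eq perm_inj). Qed.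

Lemma hdist_addr x y z : hdist (x + z) (y + z) = hdist x y.
Proof. by apply: eq_card => i; rewrite !inE !mxE (inj_eq (addIr _)). Qed.

Lemma hdist_col_perm p x y : hdist (col_perm p x) (col_perm p y) = hdist x y.
Proof.
rewrite /hdist -[RHS](card_imset _ (@perm_inj _ p^-1)); apply: eq_card => i.
rewrite -[in RHS](permK p i) mem_imset ?inE ?mxE //; exact: perm_inj.
Qed.

Lemma hdist1P x y :
  reflect (exists i, y = x + unitw i) (hdist y x == 1%N).
Proof.
apply: (iffP cards1P) => [[i /setP iP] | [i ->]]; exists i.
  apply/rowP => j; have := iP j; rewrite !inE mxE unitwE (eq_sym i).
  case: (j =P i) => [-> |_ /negbT]; last by rewrite negbK addr0 => /eqP.
  case: (F2_cases (y 0 i)) (F2_cases (x 0 i)) => [] -> [] ->;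
  by rewrite ?eqxx //= => _; apply/val_inj.
apply/setP => j; rewrite !inE mxE unitwE (eq_sym i).
case: (j == i); last by rewrite addr0 eqxx.
by rewrite -[X in _ != X]addr0 (inj_eq (addrI _)).
Qed.

(** A metric test for a coordinate to be 1: flipping it brings the word closer to 0. An isometry
    fixing 0 therefore carries coordinates to coordinates. *)
Lemma hdist_unitw_lt x i : (hdist x (unitw i) < hdist x 0)%N = (x 0 i != 0).
Proof.
apply/idP/idP => [|xi].
  apply: contraTT; rewrite negbK -leqNgt => /eqP xi.
  apply/subset_leq_card/subsetP => j; rewrite !inE unitwE mxE.
  by case: (i =P j) => [<-|//]; rewrite xi eqxx.
apply: proper_card; apply/properP; split; last first.
  by exists i; rewrite !inE ?unitwE ?mxE ?eqxx // negbK (F2_neq0 xi).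
apply/subsetP => j; rewrite !inE unitwE mxE.
by case: (i =P j) => [<-|//].
Qed.

Definition affine_perm v p : {perm word n} :=
  perm (inj_comp (@addrI _ v) (@col_perm_inj p)).

Lemma affine_permE v p x : affine_perm v p x = v + col_perm p x.
Proof. by rewrite permE. Qed.

Lemma affine_perm_isometry v p : affine_perm v p \in isometries n.
Proof.
rewrite inE; apply/forallP => x; apply/forallP => y.
by rewrite !affine_permE ![v + _]addrC hdist_addr hdist_col_perm.
Qed.

Lemma isometryE g x y : g \in isometries n -> hdist (g x) (g y) = hdist x y.
Proof. by rewrite inE => /forallP/(_ x)/forallP/(_ y)/eqP. Qed.

(** After subtracting [g 0], the map [f] fixes 0 and permutes the words of weight one; the test of
    [hdist_unitw_lt] then shows that [f] moves every coordinate of every word along the same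
    permutation. *)
Lemma isometry_affine g : g \in isometries n ->
  exists p, g = affine_perm (g 0) p.
Proof.
move=> gI; pose f x := g x + g 0.
have f0 : f 0 = 0 by rewrite /f word_addxx.
have fI x y : hdist (f x) (f y) = hdist x y by rewrite hdist_addr isometryE.
have funit i : exists j, f (unitw i) == unitw j.
  have /hdist1P[j] : hdist (f (unitw i)) 0 == 1%N.
    by rewrite -f0 fI; apply/hdist1P; exists i; rewrite add0r.
  by rewrite add0r => ->; exists j.
pose q i := xchoose (funit i).
have qP i : f (unitw i) = unitw (q i) by apply/eqP/(xchooseP (funit i)).
have unitw_inj : injective unitw.
  move=> i j /rowP/(_ i)/eqP; rewrite !unitwE eqxx.
  by case: (j =P i) => [->|].
have q_inj : injective q.
  move=> i j qij; apply: unitw_inj; apply: (addIr 0); rewrite !addr0.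
  have: f (unitw i) = f (unitw j) by rewrite !qP qij.
  by move/addIr/perm_inj.
have fP x i : f x 0 (q i) = x 0 i.
  have := hdist_unitw_lt (f x) (q i); rewrite -qP -[X in (_ < hdist _ X)%N]f0 !fI hdist_unitw_lt.
  case: (F2_cases (f x 0 (q i))) (F2_cases (x 0 i)) => [] -> [] ->;
  by rewrite ?eqxx.
(* The inverse appears because [col_perm p x] has the entry [x 0 (p i)] at [i], while [f] moves the
   entry at [i] to [q i]. *)
exists (perm q_inj)^-1%g; apply/permP => x; rewrite affine_permE.
apply/rowP => i; have [j ->] : exists j, i = perm q_inj j.
  by exists ((perm q_inj)^-1%g i); rewrite permKV.
rewrite !mxE permK permE -(fP x j) mxE addrC.
by rewrite -addrA F2_addxx addr0.
Qed.

Lemma isometry_form_affine g v p : isometry_form g v p <-> g = affine_perm v p.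
Proof.
split=> [gE | -> x]; last by rewrite affine_permE.
by apply/permP => x; rewrite affine_permE.
Qed.

Lemma affine_perm_inj v w p q :
  affine_perm v p = affine_perm w q -> v = w /\ p = q.
Proof.
move=> /permP E; have vw : v = w.
  by have := E 0; rewrite !affine_permE !col_perm0 !addr0.
split=> //; apply/permP => i; have := E (unitw (p i)).
rewrite !affine_permE vw => /addrI /rowP/(_ i); rewrite mxE [RHS]mxE !unitwE eqxx.
by case: eqP.
Qed.

Lemma is_translationP g : is_translation g <-> exists v, g = affine_perm v 1.
Proof. by split=> [[v /isometry_form_affine]|[v /isometry_form_affine]]; exists v. Qed.

Lemma affine_perm1E v x : affine_perm v 1 x = v + x.
Proof. by rewrite affine_permE; congr (_ + _); apply/rowP => i; rewrite mxE perm1. Qed.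

Lemma isometries_group_set : group_set (isometries n).
Proof.
apply/group_setP; split=> [|g h gI hI].
  by rewrite inE; apply/forallP => x; apply/forallP => y; rewrite !perm1.
rewrite inE; apply/forallP => x; apply/forallP => y.
by rewrite !permM !isometryE.
Qed.
Canonical isometries_group := group isometries_group_set.

Lemma imset_permM g h S : (g * h)%g @: S = h @: (g @: S).
Proof. by rewrite -imset_comp; apply: eq_imset => x; rewrite /= permM. Qed.

Lemma Aut_setP g S :
  reflect (g \in isometries n /\ g @: S = S) (g \in Aut_set S).
Proof.
rewrite [g \in Aut_set S]inE.
by apply: (iffP andP) => -[gI /eqP gS]; split=> //; apply/eqP.
Qed.

Lemma Aut_set_group_set S : group_set (Aut_set S).
Proof.
apply/group_setP; split=> [|g h /Aut_setP[gI gS] /Aut_setP[hI hS]].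
  apply/Aut_setP; split; first exact: group1.
  by rewrite -[RHS]imset_id; apply: eq_imset => x; rewrite perm1.
by apply/Aut_setP; split; [exact: groupM | rewrite imset_permM gS hS].
Qed.
Canonical Aut_set_group S := group (Aut_set_group_set S).

Lemma mem_translate r x S : (x \in translate r S) = (r + x \in S).
Proof.
apply/imsetP/idP => [[y yS ->]|rxS]; first by rewrite word_addKx.
by exists (r + x); rewrite ?word_addKx.
Qed.

Lemma OmegaP S y :
  reflect (exists i, y + unitw i \in S) (y \in Omega S).
Proof.
apply: (iffP bigcupP) => [[x xS]|[i yS]].
  by rewrite inE => /hdist1P[i ->]; exists i; rewrite word_addxK.
exists (y + unitw i) => //; rewrite inE; apply/hdist1P.
by exists i; rewrite word_addxK.
Qed.

(** The words with all their neighbours in [S]; this is the operation that recovers a set from its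
    [Omega]. *)
Definition Int S : {set word n} :=
  [set x | [forall i, x + unitw i \in S]].

Lemma mem_imset_perm g S x : (x \in g @: S) = (g^-1%g x \in S).
Proof. by rewrite -{1}[x](permKV g) mem_imset //; apply: perm_inj. Qed.

(** The relabelling of directions does not depend on [x]; this makes [Omega] and [Int] commute with
    isometries. *)
Lemma isometry_unitw g : g \in isometries n ->
  exists p : 'S_n, forall x i, g (x + unitw (p i)) = g x + unitw i.
Proof.
move=> /isometry_affine[p ->]; exists p => x i.
by rewrite !affine_permE col_permD addrA col_perm_unitw.
Qed.

Lemma Omega_isometry g S : g \in isometries n -> Omega (g @: S) = g @: Omega S.
Proof.
move=> /groupVr/isometry_unitw[p gE]; apply/setP => y.
rewrite mem_imset_perm; apply/OmegaP/OmegaP => -[i].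
  rewrite mem_imset_perm -[i](permKV p) gE => yS.
  by exists (p^-1%g i).
by rewrite -gE => yS; exists (p i); rewrite mem_imset_perm.
Qed.

Lemma Int_isometry g S : g \in isometries n -> Int (g @: S) = g @: Int S.
Proof.
move=> /groupVr/isometry_unitw[p gE]; apply/setP => y.
rewrite mem_imset_perm !inE; apply/forallP/forallP => yS i.
  by have := yS (p i); rewrite mem_imset_perm gE.
by rewrite -[i](permKV p) mem_imset_perm gE.
Qed.

End Words.

(** * Linear sets of words and their automorphisms *)

Section LinearSets.
Variable n : nat.
Implicit Types (x y z r v a : word n) (S K L U : {set word n}) (p q : 'S_n)
  (g h d : {perm word n}).

Definition linear_set S := 0 \in S /\ {in S &, forall x y, x + y \in S}.

Lemma linear_add S x y : linear_set S -> x \in S -> (x + y \in S) = (y \in S).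
Proof.
move=> [_ addS] xS; apply/idP/idP => yS; last exact: addS.
by rewrite -[y](word_addKx x) addS.
Qed.

(** The image of 0 is [v], so [v] lies in [S] and can be cancelled, which leaves a condition on [p]
    alone. *)
Lemma Aut_linearP S v p : linear_set S ->
  reflect (v \in S /\ forall x, (col_perm p x \in S) = (x \in S))
          (affine_perm v p \in Aut_set S).
Proof.
move=> linS; apply: (iffP (Aut_setP _ _)) => [[_ gS]|[vS pS]].
  have mem_g x : (affine_perm v p x \in S) = (x \in S).
    by rewrite -{1}gS mem_imset //; apply: perm_inj.
  have vS : v \in S.
    by have := mem_g 0; rewrite affine_permE col_perm0 addr0 => ->; case: linS.
  by split=> // x; rewrite -(mem_g x) affine_permE linear_add.
split; first exact: affine_perm_isometry.
apply/setP => x; rewrite mem_imset_perm -[RHS](_ : (affine_perm v p (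
  (affine_perm v p)^-1%g x) \in S) = _); last by rewrite permKV.
by rewrite affine_permE linear_add.
Qed.

Definition perm_stab S : {set 'S_n} :=
  [set p | [forall x, (col_perm p x \in S) == (x \in S)]].

Lemma perm_stabP S p :
  reflect (forall x, (col_perm p x \in S) = (x \in S)) (p \in perm_stab S).
Proof. by rewrite inE; apply: (iffP forallP) => H x; apply/eqP; rewrite H. Qed.

Lemma perm_stab_unitw S p i j : p \in perm_stab S ->
  (unitw (p i) + unitw (p j) \in S) = (unitw i + unitw j \in S).
Proof. by move/perm_stabP => pS; rewrite -pS col_permD !col_perm_unitw. Qed.

(** By [Aut_linearP] the translation part and the permutation part vary independently. *)
Lemma card_Aut_linear S : linear_set S ->
  #|Aut_set S| = (#|S| * #|perm_stab S|)%N.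
Proof.
move=> linS; rewrite -cardsX -(card_in_imset (f := fun u => affine_perm u.1 u.2)).
  apply: eq_card => g; apply/idP/imsetP => [gS|[[v p]]]; last first.
    rewrite inE /= => /andP[vS /perm_stabP pS] ->.
    by apply/Aut_linearP.
  have /Aut_setP[/isometry_affine[p gE] _] := gS.
  move: gS; rewrite gE => /Aut_linearP[] // vS pS.
  exists (g 0, p) => //; rewrite inE /= vS; exact/perm_stabP.
by move=> [v p] [w q] _ _ /affine_perm_inj [] /= -> ->.
Qed.

Definition hyper a K : {set word n} := [set x in K | dot a x == 0].

Lemma hyper_linear a K : linear_set K -> linear_set (hyper a K).
Proof.
move=> [K0 KD]; split=> [|x y]; first by rewrite inE K0 dot0r eqxx.
rewrite !inE => /andP[xK /eqP x0] /andP[yK /eqP y0].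
by rewrite KD // dotDr x0 y0 addr0 eqxx.
Qed.

(** Index at most two, expressed without quotients: two elements outside [U] lie in the same
    coset. *)
Definition index2 U K := U \subset K /\
  forall x y, x \in K -> y \in K -> x \notin U -> y \notin U -> x + y \in U.

Lemma hyper_index2 a K : linear_set K -> index2 (hyper a K) K.
Proof.
move=> linK; split=> [|x y xK yK]; first by apply/subsetP => x; rewrite inE => /andP[].
rewrite !inE xK yK /= => /F2_neq0 x1 /F2_neq0 y1.
by rewrite linear_add // yK dotDr x1 y1 F2_addxx eqxx.
Qed.

(** If the neighbour of [x] in direction [i] lies in [K] but not in [U], replacing [i] by [j] adds
    an element of [K] outside [U], and the new neighbour falls into [U]. *)
Lemma Omega_index2 U K : index2 U K -> linear_set K ->
  (forall i, exists j, unitw i + unitw j \in K :\: U) -> Omega U = Omega K.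
Proof.
move=> [UK U2] linK ij; apply/setP => x.
apply/OmegaP/OmegaP => -[i xK]; first by exists i; apply: (subsetP UK).
case: (boolP (x + unitw i \in U)) => [|xU]; first by exists i.
have [j] := ij i; rewrite inE => /andP[jU jK]; exists j.
rewrite -[unitw j](word_addKx (unitw i)) addrA; exact: U2.
Qed.

(** [U] contains its double annihilator; a pointwise form that is checked on explicit functionals,
    without dimensions. *)
Definition perp_closed U :=
  forall x, (forall a, (forall u, u \in U -> dot a u = 0) -> dot a x = 0) -> x \in U.

Lemma hyper_perp_closed a K : perp_closed K -> perp_closed (hyper a K).
Proof.
move=> Kpp x Hx; rewrite inE Kpp /= => [|b bK].
  by apply/eqP/Hx => u; rewrite inE => /andP[_ /eqP].
by apply: Hx => u; rewrite inE => /andP[uK _]; apply: bK.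
Qed.

(** * Kernels of the class sums of a partition of the coordinates *)

Variable T : finType.
Implicit Type f : 'I_n -> T.

Definition indicator (P : pred 'I_n) : word n := \row_i (P i)%:R.

Lemma dot_indicator P x : dot (indicator P) x = \sum_(i | P i) x 0 i.
Proof.
rewrite big_mkcond; apply: eq_bigr => i _; rewrite mxE.
by case: (P i); rewrite ?mul1r ?mul0r.
Qed.

Definition cker f : {set word n} :=
  [set x : word n | [forall c, \sum_(i | f i == c) x 0 i == 0]].

Lemma ckerP f x :
  reflect (forall c, \sum_(i | f i == c) x 0 i = 0) (x \in cker f).
Proof. by rewrite inE; apply: (iffP forallP) => H c; apply/eqP; rewrite H. Qed.

Lemma sum_addw (P : pred 'I_n) (x y : word n) :
  \sum_(j | P j) (x + y) 0 j = \sum_(j | P j) x 0 j + \sum_(j | P j) y 0 j.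
Proof. by rewrite -big_split; apply: eq_bigr => i _; rewrite mxE. Qed.

Lemma cker_linear f : linear_set (cker f).
Proof.
split=> [|x y /ckerP xf /ckerP yf]; apply/ckerP => c.
  by apply: big1 => i _; rewrite mxE.
by rewrite sum_addw xf yf addr0.
Qed.

Lemma cker_perp_closed f : perp_closed (cker f).
Proof.
move=> x Hx; apply/ckerP => c; rewrite -dot_indicator.
by apply: Hx => u /ckerP; rewrite dot_indicator.
Qed.

(** A functional that is constant on the classes is a combination of the class sums. *)
Lemma cker_dot f a x : (forall i j, f i = f j -> a 0 i = a 0 j) ->
  x \in cker f -> dot a x = 0.
Proof.
move=> af /ckerP xf; rewrite /dot (partition_big f predT) //=.
apply: big1 => c _; case: (pickP [pred i | f i == c]) => [j /= /eqP fj|no].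
  rewrite (eq_bigr (fun i => a 0 j * x 0 i)) => [|i /eqP fi].
    by rewrite -mulr_sumr xf mulr0.
  by rewrite (af i j) // fi fj.
by rewrite big_pred0.
Qed.

Lemma sum_unitw (P : pred 'I_n) i :
  \sum_(j | P j) unitw i 0 j = (P i)%:R :> 'F_2.
Proof.
rewrite big_mkcond (bigD1 i) //= big1 => [|j ji].
  by rewrite unitwE eqxx addr0; case: (P i).
by rewrite unitwE eq_sym (negbTE ji) if_same.
Qed.

Lemma cker_unitw f i j : (unitw i + unitw j \in cker f) = (f i == f j).
Proof.
apply/ckerP/eqP => [/(_ (f j))|fij c]; rewrite sum_addw !sum_unitw.
  by rewrite eqxx; case: eqP.
by rewrite fij F2_addxx.
Qed.

(** If [x + unitw j + unitw i] is in the kernel, then [x] has sum 0 on any third class. Leaving [x]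
    in a direction [k] of that class, the correcting direction [l] must be in the same class, so the
    two changes cancel in every class sum and [x] itself is in the kernel. *)
Lemma Int_Omega_cker f : (forall i j, exists k, f k != f i /\ f k != f j) ->
  Int (Omega (cker f)) = cker f.
Proof.
move=> f3; apply/setP => x; rewrite inE; have linf := cker_linear f.
apply/forallP/idP => [xO|xf i]; last first.
  by apply/OmegaP; exists i; rewrite word_addxK.
apply/negPn/negP => xNf.
have [j _] : exists j : 'I_n, True.
  case: (pickP (@predT 'I_n)) => [j _|no]; first by exists j.
  by case/negP: xNf; apply/ckerP => c; apply: big1 => i; have := no i.
have /OmegaP[i xji] := xO j; have [k [kj ki]] := f3 j i.
have /OmegaP[l xkl] := xO k.
have kl : f k == f l.
  move: xji xkl => /ckerP/(_ (f k)) + /ckerP/(_ (f k)).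
  rewrite !sum_addw !sum_unitw eqxx -(eq_sym (f k)) (negbTE kj).
  rewrite -(eq_sym (f k)) (negbTE ki) !addr0 => ->; rewrite add0r eq_sym.
  by case: eqP.
move: xkl; rewrite -addrA [x + _]addrC linear_add ?cker_unitw // => xf.
by rewrite xf in xNf.
Qed.

(** The sums of two unit words that lie in the kernel determine the partition, and the partition
    determines the kernel. *)
Lemma perm_stab_cker f p :
  (p \in perm_stab (cker f)) = [forall i, forall j, (f (p i) == f (p j)) == (f i == f j)].
Proof.
apply/idP/forallP => [pf i|pf].
  by apply/forallP => j; rewrite -!cker_unitw perm_stab_unitw.
have {}pf i j : (f (p i) == f (p j)) = (f i == f j) by have /forallP/(_ j)/eqP := pf i.
have dotp x i : \sum_(j | f j == f i) col_perm p x 0 j = \sum_(j | f j == f (p i)) x 0 j.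
  rewrite [RHS](reindex_inj (@perm_inj _ p)); apply: eq_big => j; first by rewrite pf.
  by rewrite mxE.
have ckerP' x : reflect (forall i, \sum_(j | f j == f i) x 0 j = 0) (x \in cker f).
  apply: (iffP (ckerP _ _)) => [xf i|xf c]; first exact: xf.
  case: (pickP [pred i | f i == c]) => [i /= /eqP <-|no]; first exact: xf.
  by rewrite big_pred0.
apply/perm_stabP => x; apply/ckerP'/ckerP' => xf i; last by rewrite dotp.
by rewrite -(permKV p i) -dotp.
Qed.

End LinearSets.

(** * The partitions of the coordinates *)

Lemma pow2_gt0 k : (0 < 2 ^ k)%N.
Proof. by rewrite expn_gt0. Qed.

Lemma mod_double a N :
  (a %% N.*2 = a %% N + (N <= a %% N.*2) * N)%N.
Proof.
case: (posnP N) => [->|N0]; first by rewrite double0 !modn0 muln0 addn0.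
have lt2 : (a %% N.*2 < N.*2)%N by rewrite ltn_mod double_gt0.
have <- : (a %% N.*2 %% N = a %% N)%N by rewrite modn_dvdm // -muln2 dvdn_mulr.
move: (_ %% _)%N lt2 => b bN; case: leqP => Nb; last by rewrite modn_small // addn0.
have -> : (b %% N = b - N)%N.
  by rewrite -{1}(subnK Nb) modnDr modn_small //; lia.
by rewrite mul1n subnK.
Qed.

Lemma mod_flip Q N i : (0 < N)%N -> (i < Q * N.*2)%N ->
  exists j, [/\ (j < Q * N.*2)%N, j = i %[mod N]
    & (j %% N.*2 < N)%N != (i %% N.*2 < N)%N].
Proof.
move=> N0 iQ; have iE := divn_eq i N.*2.
have qQ : (i %/ N.*2 < Q)%N by rewrite ltn_divLR ?double_gt0.
have b2 : (i %% N.*2 < N.*2)%N by rewrite ltn_mod double_gt0.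
move: (i %/ _)%N (i %% _)%N iE qQ b2 => q b {iQ}-> qQ b2.
have qb c : (c < N.*2)%N -> (q * N.*2 + c < Q * N.*2)%N.
  move=> cN; have : (q.+1 * N.*2 <= Q * N.*2)%N by rewrite leq_mul2r qQ orbT.
  by rewrite mulSn; lia.
have dN c : (q * N.*2 + c = c %[mod N])%N.
  by rewrite -muln2 mulnCA mulnC modnMDl.
case: (ltnP b N) => bN.
  exists (q * N.*2 + (b + N))%N; split; [by apply: qb; lia| |].
    by rewrite !dN modnDr.
  by rewrite modnMDl modn_small; lia.
exists (q * N.*2 + (b - N))%N; split; [by apply: qb; lia| |].
  by rewrite !dN -[in RHS](subnK bN) modnDr.
by rewrite modnMDl modn_small; lia.
Qed.

Section Levels.
Variable m : nat.
Implicit Types (t s : nat) (i j k : 'I_(2 ^ m)) (x y r : word (2 ^ m)).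

Definition cls t i : 'I_(2 ^ (m - t)) := Ordinal (ltn_pmod i (pow2_gt0 (m - t))).

Definition lohalf t i : bool := (i %% (2 ^ (m - t)).*2 < 2 ^ (m - t))%N.

Definition K t : {set word (2 ^ m)} := cker (cls t).
Definition hw t : word (2 ^ m) := indicator (lohalf t).
Definition U t : {set word (2 ^ m)} := hyper (hw t) (K t).

Lemma K_linear t : linear_set (K t). Proof. exact: cker_linear. Qed.
Lemma U_linear t : linear_set (U t). Proof. exact/hyper_linear/cker_linear. Qed.

Lemma U_index2 t : index2 (U t) (K t). Proof. exact/hyper_index2/cker_linear. Qed.

Lemma U_perp_closed t : perp_closed (U t).
Proof. exact/hyper_perp_closed/cker_perp_closed. Qed.

Lemma pow2_pred t : (0 < t <= m)%N -> (2 ^ (m - t.-1) = (2 ^ (m - t)).*2)%N.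
Proof. by move=> tm; rewrite -mul2n -expnS; congr (_ ^ _)%N; lia. Qed.

Lemma clsS t i j : (0 < t <= m)%N ->
  (cls t.-1 i == cls t.-1 j) = (cls t i == cls t j) && (lohalf t i == lohalf t j).
Proof.
move=> tm; rewrite -!val_eqE /= /lohalf pow2_pred //.
have := pow2_gt0 (m - t); set N := (2 ^ _)%N => N0.
have := mod_double i N; have := mod_double j N.
have : (i %% N < N)%N by rewrite ltn_mod.
have : (j %% N < N)%N by rewrite ltn_mod.
move: (i %% N.*2)%N (i %% N)%N (j %% N.*2)%N (j %% N)%N => a b c d dN bN.
case: (leqP N a); case: (leqP N c); rewrite ?mul1n ?mul0n ?addn0 => ? ? cE aE;
by rewrite cE aE; lia.
Qed.

Lemma cls_flip t i : (0 < t <= m)%N ->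
  exists j, cls t j = cls t i /\ lohalf t j != lohalf t i.
Proof.
move=> tm; have mE : (2 ^ m = 2 ^ t.-1 * (2 ^ (m - t)).*2)%N.
  by rewrite -pow2_pred // -expnD; congr (_ ^ _)%N; lia.
have := ltn_ord i; rewrite [X in (_ < X)%N]mE.
move=> /(mod_flip (pow2_gt0 _)) [j []]; rewrite -mE => jm jE jh.
by exists (Ordinal jm); split => //; apply/val_inj.
Qed.

Lemma cls_three t : (t.+1 < m)%N -> forall i j, exists k, cls t k != cls t i /\ cls t k != cls t j.
Proof.
move=> tm i j; have N4 : (4 <= 2 ^ (m - t))%N.
  by apply: (@leq_trans (2 ^ 2)); rewrite ?leq_exp2l //; lia.
have Nm : (2 ^ (m - t) <= 2 ^ m)%N by rewrite leq_exp2l // leq_subr.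
have km c : (c < 3 -> c < 2 ^ m)%N by lia.
have kE c (c3 : (c < 3)%N) i' : (cls t (Ordinal (km c c3)) == cls t i') = (c == i' %% 2 ^ (m - t))%N.
  by rewrite -val_eqE /= modn_small //; lia.
(* Two coordinates occupy at most two of the residues 0, 1, 2, and there are at least four
   residues. *)
move: (kE 0%N isT) (kE 1%N isT) (kE 2%N isT) => k0 k1 k2.
case: (boolP ((0 == i %% 2 ^ (m - t)) || (0 == j %% 2 ^ (m - t))))%N => h0; last first.
  by exists (Ordinal (km 0%N isT)); rewrite !k0; lia.
case: (boolP ((1 == i %% 2 ^ (m - t)) || (1 == j %% 2 ^ (m - t))))%N => h1; last first.
  by exists (Ordinal (km 1%N isT)); rewrite !k1; lia.
by exists (Ordinal (km 2%N isT)); rewrite !k2; lia.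
Qed.

Lemma Int_Omega_K t : (t.+1 < m)%N -> Int (Omega (K t)) = K t.
Proof. by move=> tm; apply/Int_Omega_cker/cls_three. Qed.

Lemma half_dot t x : dot (hw t) x = \sum_(i | lohalf t i) x 0 i.
Proof. exact: dot_indicator. Qed.

(** Both the class sums of level [t] and the half [hw t] are constant on the finer classes of level
    [t.-1]. *)
Lemma K_pred_sub t : (0 < t <= m)%N -> K t.-1 \subset U t.
Proof.
move=> tm; apply/subsetP => x xK; rewrite inE; apply/andP; split.
  apply/ckerP => c; rewrite -dot_indicator; apply: cker_dot xK => i j /eqP.
  by rewrite clsS // => /andP[/eqP ij _]; rewrite !mxE ij.
apply/eqP; apply: cker_dot xK => i j /eqP.
by rewrite clsS // => /andP[_ /eqP ij]; rewrite !mxE ij.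
Qed.

(** The pairs of unit words see only the finer partition, so that a permutation preserving [U t]
    preserves [cls t.-1]. *)
Lemma U_unitw t i j : (0 < t <= m)%N ->
  (unitw i + unitw j \in U t) = (cls t.-1 i == cls t.-1 j).
Proof.
move=> tm; rewrite inE cker_unitw clsS //; congr andb.
rewrite half_dot sum_addw !sum_unitw.
by case: (lohalf t i); case: (lohalf t j).
Qed.

Lemma Omega_U t : (0 < t <= m)%N -> Omega (U t) = Omega (K t).
Proof.
move=> tm; apply: Omega_index2 (U_index2 t) (K_linear t) _ => i.
have [j [ji hji]] := cls_flip i tm; exists j.
by rewrite inE cker_unitw ji eqxx andbT U_unitw // clsS // ji eqxx /= eq_sym.
Qed.

End Levels.

(** * The automorphism groups of the two structures *)

Lemma natr_F2 k : k%:R = (odd k)%:R :> 'F_2.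
Proof.
rewrite -{1}(odd_double_half k) natrD -addnn natrD F2_addxx addr0 //.
Qed.

Lemma even_wordE n (v : word n) : even_word v = (\sum_i v 0 i == 0).
Proof.
rewrite /even_word /hdist.
have -> : \sum_i v 0 i = #|[set i | v 0 i != (0 : word n) 0 i]|%:R.
  rewrite -sum1_card natr_sum [RHS]big_mkcond /=; apply: eq_bigr => i _.
  by rewrite inE mxE; case: (F2_cases (v 0 i)) => ->.
by rewrite natr_F2; case: (odd _).
Qed.

(** * The space [V t] as a complement of [K (t - 1)] in [U t] *)

Section LevelV.
Variables m t : nat.
Hypothesis tm : (0 < t <= m)%N.
Implicit Types (i j k l : 'I_(2 ^ m)) (x y r u : word (2 ^ m)).
Let N := (2 ^ (m - t))%N.

Lemma leN2 : (N.*2 <= 2 ^ m)%N.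
Proof. by rewrite -pow2_pred // leq_exp2l // leq_subr. Qed.

Lemma leN : (N <= 2 ^ m)%N.
Proof. by apply: leq_trans leN2; rewrite -addnn leq_addr. Qed.

Definition supp2 r := forall i, (N.*2 <= i)%N -> r 0 i = 0.

Lemma supp2_half r : supp2 r ->
  \sum_(i | lohalf t i) r 0 i = \sum_(j < N) r 0 (widen_ord leN j).
Proof.
move=> r2; rewrite -(big_ord_narrow leN) big_mkcond [RHS]big_mkcond.
apply: eq_bigr => i _; case: (ltnP i N.*2) => iN; last by rewrite r2 // !if_same.
by rewrite /lohalf -/N modn_small.
Qed.

Lemma supp2_cls r i j : supp2 r -> (i < N)%N -> j = (i + N)%N :> nat ->
  \sum_(l | cls t l == cls t i) r 0 l = r 0 i + r 0 j.
Proof.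
move=> r2 iN ji; rewrite (bigD1 i) //= (bigD1 j) /=; last first.
  by rewrite -!val_eqE /= ji modnDr eqxx /= -{2}[val i]addn0 eqn_add2l -lt0n pow2_gt0.
rewrite big1 ?addr0 // => l /andP[/andP[]]; rewrite -!val_eqE /= => lc li lj.
apply: r2; rewrite leqNgt; apply/negP => lN2; move/eqP: lc.
rewrite -/N (modn_small iN); case: (ltnP l N) => lN.
  by rewrite modn_small // => E; rewrite E eqxx in li.
rewrite -{1}(subnK lN) modnDr modn_small => [E|]; last by lia.
by move/eqP: lj; rewrite ji -E subnK.
Qed.

Lemma supp2_cls_pred r i : supp2 r -> (i < N.*2)%N ->
  \sum_(l | cls t.-1 l == cls t.-1 i) r 0 l = r 0 i.
Proof.
move=> r2 iN; rewrite (bigD1 i) //= big1 ?addr0 // => l /andP[].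
rewrite -!val_eqE /= pow2_pred // -/N (modn_small iN) => lc li.
apply: r2; rewrite leqNgt; apply/negP => lN2; case/negP: li.
by rewrite modn_small in lc.
Qed.

Lemma twiceE (v : word N) i : @twice m t v 0 i =
  ([seq v 0 c | c <- enum 'I_N] ++ [seq v 0 c | c <- enum 'I_N])`_i.
Proof. by rewrite mxE. Qed.

Lemma twice_supp v : supp2 (@twice m t v).
Proof.
move=> i iN; rewrite twiceE nth_default // size_cat size_map size_enum_ord.
by rewrite addnn.
Qed.

Lemma twice_lo v i (j : 'I_N) : val i = val j -> @twice m t v 0 i = v 0 j.
Proof.
move=> ij; rewrite twiceE nth_cat size_map size_enum_ord ij /= ltn_ord.
by rewrite (nth_map j) ?size_enum_ord // nth_ord_enum.
Qed.

Lemma twice_hi v i (j : 'I_N) : val i = (j + N)%N -> @twice m t v 0 i = v 0 j.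
Proof.
move=> ij; rewrite twiceE nth_cat size_map size_enum_ord ij /=.
rewrite ltnNge leq_addl /= addnK.
by rewrite (nth_map j) ?size_enum_ord // nth_ord_enum.
Qed.

(** Each class modulo [N] meets the first [2 N] coordinates in one pair [i], [i + N]: a zero class
    sum says that the two copies agree, and orthogonality to [hw t] says that the copied word is
    even. *)
Lemma VP r : reflect (r \in U m t /\ supp2 r) (r \in V m t).
Proof.
apply: (iffP imsetP) => [[v]|[rU r2]].
  rewrite inE even_wordE => /eqP v0 ->; have r2 := @twice_supp v; split => //.
  rewrite inE half_dot supp2_half //; apply/andP; split; last first.
    rewrite -[X in _ == X]v0; apply/eqP/eq_bigr => j _; exact: twice_lo.
  apply/ckerP => c.
  have c1 : (c < 2 ^ m)%N by apply: leq_trans (ltn_ord c) leN.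
  have c2 : (c + N < 2 ^ m)%N.
    by apply: leq_trans leN2; rewrite -addnn ltn_add2r; apply: ltn_ord.
  have -> : c = cls t (Ordinal c1) by apply/val_inj; rewrite /= modn_small.
  rewrite (@supp2_cls _ _ (Ordinal c2)) //=.
  by rewrite (@twice_lo v _ c) // (@twice_hi v _ c) // F2_addxx.
exists (\row_j r 0 (widen_ord leN j)).
  rewrite inE even_wordE; move: rU; rewrite inE half_dot supp2_half // => /andP[_].
  by congr (_ == _); apply: eq_bigr => j _; rewrite mxE.
apply/rowP => i; case: (ltnP i N) => iN.
  by rewrite (@twice_lo _ _ (Ordinal iN)) // mxE; congr (r 0 _); apply/val_inj.
case: (ltnP i N.*2) => i2; last by rewrite twice_supp ?r2.
have jN : (i - N < N)%N by lia.
rewrite (@twice_hi _ _ (Ordinal jN)) /= ?subnK // mxE.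
have /andP[/ckerP rK _] : (r \in K m t) && (dot (hw m t) r == 0) by rewrite inE in rU.
have := @supp2_cls r (widen_ord leN (Ordinal jN)) i r2 jN.
by rewrite /= subnK // rK => /(_ erefl)/esym/eqP; rewrite addrC; case: (F2_cases (r 0 i)) (F2_cases (r 0 (widen_ord leN (Ordinal jN)))) => [] -> [] ->.
Qed.

Lemma V_sub_U : V m t \subset U m t.
Proof. by apply/subsetP => r /VP[]. Qed.

Lemma V_linear : linear_set (V m t).
Proof.
have [U0 UD] := U_linear m t.
split=> [|x y /VP[xU x2] /VP[yU y2]]; apply/VP; split=> [|i iN]; rewrite ?mxE //.
  exact: UD.
by rewrite x2 // y2 // addr0.
Qed.

(** Each class modulo [2 N] meets the support region in a single coordinate, which is then the class
    sum. *)
Lemma V_cap_K r : r \in V m t -> r \in K m t.-1 -> r = 0.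
Proof.
move=> /VP[_ r2] /ckerP rK; apply/rowP => i; rewrite mxE.
by case: (ltnP i N.*2) => [iN|/r2//]; rewrite -supp2_cls_pred.
Qed.

(** The component [r] stores the sums of [u] over the classes modulo [2 N] in the first [2 N]
    coordinates. Together with [V_cap_K] this makes [U t] the direct sum of [V t] and [K t.-1]. *)
Lemma U_decomp u : u \in U m t -> exists2 r, r \in V m t & r + u \in K m t.-1.
Proof.
move=> uU; pose r : word (2 ^ m) := \row_i (if (i < N.*2)%N then
  \sum_(l | cls t.-1 l == cls t.-1 i) u 0 l else 0).
have r2 : supp2 r by move=> i; rewrite mxE ltnNge => ->.
have ruK : r + u \in K m t.-1.
  apply/ckerP => c; rewrite sum_addw.
  have cN : (c < N.*2)%N by rewrite -pow2_pred.
  have cm := leq_trans cN leN2.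
  have -> : c = cls t.-1 (Ordinal cm) by apply/val_inj; rewrite /= modn_small.
  by rewrite supp2_cls_pred //= mxE cN F2_addxx.
exists r => //; apply/VP; split=> //.
rewrite -(linear_add _ (U_linear m t) (subsetP (K_pred_sub tm) _ ruK)).
by rewrite addrAC word_addxx add0r.
Qed.

Lemma U_add r (k : word (2 ^ m)) : r \in V m t -> k \in K m t.-1 -> r + k \in U m t.
Proof.
move=> /(subsetP V_sub_U) rU /(subsetP (K_pred_sub tm)) kU.
by case: (U_linear m t) => _; apply.
Qed.

End LevelV.

Lemma K0 m : K m 0 = [set 0].
Proof.
apply/setP => x; rewrite in_set1; apply/ckerP/eqP => [xK|-> c]; last first.
  by apply: big1 => i _; rewrite mxE.
apply/rowP => i; rewrite mxE -(xK (cls 0 i)) (bigD1 i) //= big1 ?addr0 // => j.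
rewrite -!val_eqE /= !modn_small ?subn0 ?ltn_ord //.
by move=> /andP[/eqP -> /eqP].
Qed.

Lemma V1 m : (0 < m)%N -> V m 1 = U m 1.
Proof.
move=> m0; apply/eqP; rewrite eqEsubset V_sub_U ?m0 //=.
apply/subsetP => u /U_decomp[]; first by rewrite m0.
move=> r rV; rewrite K0 inE word_eq_add => /eqP <- //.
Qed.

(** For [t = m] the copied word is a single even bit, so [V m m] is trivial. *)
Lemma Um m : (0 < m)%N -> U m m = K m m.-1.
Proof.
move=> m0; have mm : (0 < m <= m)%N by rewrite m0 /=.
apply/eqP; rewrite eqEsubset K_pred_sub // andbT.
apply/subsetP => u uU; have [r rV] := U_decomp mm uU.
suff -> : r = 0 by rewrite add0r.
have /imsetP[v] := rV; rewrite inE even_wordE => /eqP v0 ->.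
have {}v0 j : v 0 j = 0.
  rewrite -[RHS]v0 (bigD1 j) //= big1 ?addr0 // => k; rewrite -val_eqE /=.
  have := ltn_ord j; have := ltn_ord k; rewrite {2 4}subnn expn0.
  by case: (val k) (val j) => [|?] [].
have s0 k : [seq v 0 j | j <- enum 'I_(2 ^ (m - m))]`_k = 0.
  case: (ltnP k (size (enum 'I_(2 ^ (m - m))))) => km.
    by rewrite (nth_map (Ordinal (pow2_gt0 (m - m)))).
  by rewrite nth_default // size_map.
by apply/rowP => i; rewrite twiceE mxE nth_cat !s0 if_same.
Qed.

(** * Translates of sets of words *)

Section Translates.
Variable n : nat.
Implicit Types (r s v x : word n) (p : 'S_n) (S : {set word n}).

Lemma translateD r s S : translate (r + s) S = translate r (translate s S).
Proof. by apply/setP => x; rewrite !mem_translate addrA [s + r]addrC. Qed.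

Lemma Omega_translate r S : Omega (translate r S) = translate r (Omega S).
Proof.
apply/setP => x; rewrite mem_translate.
by apply/OmegaP/OmegaP => -[i]; rewrite ?mem_translate => xS; exists i;
   rewrite ?mem_translate addrA in xS *.
Qed.

Lemma Int_translate r S : Int (translate r S) = translate r (Int S).
Proof.
apply/setP => x; rewrite mem_translate !inE.
by apply: eq_forallb => i; rewrite mem_translate addrA.
Qed.

Lemma translate_linear r S : linear_set S -> r \in S -> translate r S = S.
Proof. by move=> linS rS; apply/setP => x; rewrite mem_translate linear_add. Qed.

Lemma imset_affine v p r S :
  affine_perm v p @: translate r S = translate (affine_perm v p r) (affine_perm 0 p @: S).
Proof.
rewrite /translate -!imset_comp; apply: eq_imset => x /=.
by rewrite !affine_permE col_permD addrA add0r.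
Qed.

End Translates.

Section Automorphisms.
Variable m : nat.
Implicit Types (x y r : word (2 ^ m)) (S : {set word (2 ^ m)}).

(* [Omega (K m t)] determines [K m t] only if the partition has at least three
   classes; with two classes the words that have all their neighbours in it
   are all the words of even weight. *)
Definition L t : {set word (2 ^ m)} := if t.+1 == m then K m m else K m t.

Lemma Omega_L t : Omega (L t) = Omega (K m t).
Proof.
rewrite /L; case: eqP => // tm; rewrite -Omega_U ?leqnn -?tm //=.
by rewrite tm Um -?tm.
Qed.

Lemma Int_Omega_L t : (0 < t < m)%N -> Int (Omega (K m t)) = L t.
Proof.
move=> /andP[t0 tm]; rewrite -Omega_L /L; case: eqP => [{}tm|/eqP tm']; last first.
  by apply: Int_Omega_K; rewrite ltn_neqAle tm' tm.
apply/setP => x; rewrite inE; apply/forallP/idP => [xO|xK i]; last first.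
  by apply/OmegaP; exists i; rewrite word_addxK.
have /OmegaP[j] := xO (Ordinal (pow2_gt0 m)).
rewrite -addrA addrC linear_add //; first exact: K_linear.
by rewrite cker_unitw -val_eqE /= subnn expn0 !modn1.
Qed.

(** By induction the neighbourhood of [A (t - 1)] is that of [K (t - 1)]; adding [V t] to both gives
    [A t] on one side and [U t] on the other. *)
Lemma Omega_A t : (0 < t <= m)%N -> Omega (A m t) = Omega (U m t).
Proof.
elim: t => // t IH; case: t IH => [_ m0|t IH tm].
  by rewrite -V1 // ltnW.
have tm' : (0 < t.+1 <= m)%N by rewrite /= ltnW; case/andP: tm.
have {IH} := IH tm'; rewrite Omega_U // => IH; apply/setP => x.
apply/OmegaP/OmegaP => -[i].
  case/imset2P => r a rV aA xE.
  have /OmegaP[j jK] : r + x \in Omega (K m t.+1).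
    by rewrite -IH; apply/OmegaP; exists i; rewrite -addrA xE word_addKx.
  by exists j; have := U_add tm rV jK; rewrite -addrA word_addKx.
case/(U_decomp tm) => r rV rxK.
have /OmegaP[j jA] : r + x \in Omega (A m t.+1).
  by rewrite IH; apply/OmegaP; exists i; rewrite -addrA.
exists j; apply/imset2P; exists r (r + x + unitw j) => //.
by rewrite -addrA word_addKx.
Qed.

(** [Omega] and [Int] commute with isometries and exchange [L t] and [Omega (K t)]. *)
Lemma calA_L t : (0 < t < m)%N -> calA m t = Aut_set (L t).
Proof.
move=> tm; have tm' : (0 < t <= m)%N by case/andP: tm => -> /ltnW.
rewrite /calA Omega_A // Omega_U //; apply/setP => g.
apply/Aut_setP/Aut_setP => -[gI gS]; split=> //.
  by rewrite -Int_Omega_L // -Int_isometry // gS.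
by rewrite -Omega_L -Omega_isometry // gS.
Qed.

(** Applying [Int] to the members of the collection gives the cosets [r + K (t - 1)], whose union is
    [U t]. Conversely the permutation part of an automorphism of [U t] preserves the partition
    [cls t.-1], hence [K (t - 1)] and the set of its cosets. *)
Lemma calB_U t : (0 < t < m)%N -> calB m t = Aut_set (U m t).
Proof.
move=> tm; have tm' : (0 < t <= m)%N by case/andP: tm => -> /ltnW.
rewrite /calB; case: eqP => [->|/eqP t1]; first by rewrite -V1 //; lia.
have sm : (0 < t.-1 < m)%N by lia.
have sm' : (0 < t.-1 <= m)%N by lia.
have sL : L t.-1 = K m t.-1 by rewrite /L; case: eqP => //; lia.
rewrite Omega_A // Omega_U //; apply/setP => g; apply/idP/Aut_setP.
  rewrite inE => /andP[gI /forallP gS]; split=> //.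
  apply/eqP; rewrite eqEcard card_imset ?leqnn ?andbT; last exact: perm_inj.
  apply/subsetP => _ /imsetP[u uU ->].
  have [r rV ruK] := U_decomp tm' uU.
  have /implyP/(_ (imset_f (fun r => translate r _) rV)) := gS (translate r (Omega (K m t.-1))).
  case/imsetP => r' r'V E.
  have : g u \in g @: Int (translate r (Omega (K m t.-1))).
    by rewrite imset_f // Int_translate mem_translate Int_Omega_L // sL.
  rewrite -Int_isometry // E Int_translate mem_translate Int_Omega_L // sL.
  by move/(U_add tm' r'V); rewrite word_addKx.
move=> [gI gU]; rewrite inE gI; apply/forallP => S; apply/implyP.
case/imsetP => r rV ->.
have [p] := isometry_affine gI; move: (g 0) => v gE; have linU := U_linear m t.
have : g \in Aut_set (U m t) by apply/Aut_setP.
rewrite gE => /Aut_linearP-/(_ linU)[vU pU].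
have pK : affine_perm 0 p @: K m t.-1 = K m t.-1.
  have linK := K_linear m t.-1.
  apply: (Aut_setP _ _ _).2; apply/Aut_linearP => //; split; first by case: linK.
  apply/perm_stabP; rewrite perm_stab_cker; apply/forallP => i; apply/forallP => j.
  by rewrite -!U_unitw // perm_stab_unitw //; apply/perm_stabP.
rewrite imset_affine -Omega_isometry ?affine_perm_isometry // pK.
have : g r \in U m t by rewrite -gU imset_f // (subsetP (V_sub_U tm')).
rewrite gE => /(U_decomp tm')[r' r'V r'gK]; apply/imsetP; exists r' => //.
rewrite -[X in translate X _](word_addKx r') translateD; congr translate.
by rewrite -Omega_translate (translate_linear (K_linear m t.-1)).
Qed.

End Automorphisms.

(** * Coset representatives and annihilators of unions *)

Section Reps.
Variable n : nat.
Implicit Types (x y r u v w a : word n) (S K U V : {set word n})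
  (g d : {perm word n}) (D : {set {perm word n}}).

(** Over the field of two elements closure under addition is already linearity, so the span of [S]
    is [S]. *)
Lemma linear_set_affine v S : linear_set S -> is_affine (translate v S).
Proof.
move=> [S0 SD]; exists v, <<enum S>>%VS; apply/setP => x.
rewrite mem_translate inE word_oppr addrC; apply/idP/idP => [xS|].
  by apply: memv_span; rewrite mem_enum.
move/(coord_span (X := in_tuple (enum S))) => ->.
apply: (big_ind (fun y : word n => y \in S)) => // i _; case: (F2_cases (coord (in_tuple (enum S)) i (x + v))) => ->.
  by rewrite scale0r.
by rewrite scale1r -mem_enum mem_nth.
Qed.

(** Representatives of the cosets of [Aut_set U] in [Aut_set K]; the last clause retains that
    representatives of translated cosets differ by a translation. *)
Definition reps K U D : Prop :=
  [/\ D \subset Aut_set K,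
      forall g, g \in Aut_set K -> #|D :&: (Aut_set U :* g)%g| = 1%N &
      forall d1 d2, d1 \in D -> d2 \in D ->
        (exists2 tau, is_translation tau &
           Aut_set U :* d1 = (Aut_set U :* d2) :* tau)%g ->
        exists w, forall x, d1 x = w + d2 x].

(** The invariant carried through the levels: as far as constant functionals are concerned, [S]
    cannot be told from [U]. *)
Definition full U S : Prop :=
  [/\ S != set0, S \subset U
    & forall a c, (forall s, s \in S -> dot a s = c) ->
      forall u, u \in U -> dot a u = 0].

Lemma linear_full U : linear_set U -> full U U.
Proof.
move=> [U0 _]; split=> // [|a c ac u uU]; first by apply/set0Pn; exists 0.
by rewrite ac // -(ac 0) // dot0r.
Qed.

Lemma affine_perm_diff v p x y :
  affine_perm v p (x + y) = affine_perm v p x + col_perm p y.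
Proof. by rewrite !affine_permE col_permD addrA. Qed.

Variables (K U : {set word n}) (D : {set {perm word n}}).
Hypotheses (linK : linear_set K) (linU : linear_set U) (repsD : reps K U D).

Lemma reps_isometry d : d \in D -> d \in isometries n.
Proof. by case: repsD => /subsetP DK _ _ /DK/Aut_setP[]. Qed.

Lemma reps_affine d : d \in D -> exists p, d = affine_perm (d 0) p.
Proof. by move/reps_isometry/isometry_affine. Qed.

Lemma reps_mem d x : d \in D -> (d x \in K) = (x \in K).
Proof.
case: repsD => /subsetP DK _ _ /DK/Aut_setP[_ dK].
by rewrite -{1}dK mem_imset //; apply: perm_inj.
Qed.

(** A coset of [Aut_set U] is determined by the common image of [U] under its members, so cosets are
    compared through these images. *)
Lemma rcoset_Aut_set g h : g \in isometries n -> h \in isometries n ->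
  (h \in Aut_set U :* g)%g = (g @: U == h @: U).
Proof.
move=> gI hI; rewrite mem_rcoset; apply/Aut_setP/eqP => [[_ E]|E].
  by rewrite -{1}E -imset_permM mulgKV.
by split; rewrite ?groupM ?groupV // imset_permM -E -imset_permM mulgV
  -[RHS]imset_id; apply: eq_imset => x; rewrite perm1.
Qed.

Lemma reps_inj d1 d2 : d1 \in D -> d2 \in D -> d1 @: U = d2 @: U -> d1 = d2.
Proof.
move=> D1 D2 E; have [/subsetP DK D_1 _] := repsD.
have /eqP/cards1P[d dE] := D_1 _ (DK _ D1).
have : d1 \in [set d] by rewrite -dE inE D1 rcoset_Aut_set ?reps_isometry ?eqxx.
have : d2 \in [set d] by rewrite -dE inE D2 rcoset_Aut_set ?reps_isometry // E eqxx.
by move=> /set1P -> /set1P ->.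
Qed.

Lemma reps_exists g : g \in Aut_set K -> exists2 d, d \in D & d @: U = g @: U.
Proof.
move=> gK; have [_ D_1 _] := repsD.
have /eqP/cards1P[d dE] := D_1 _ gK.
have : d \in [set d] by rewrite inE.
rewrite -dE inE => /andP[dD]; exists d => //; apply/esym/eqP.
have [gI _] := Aut_setP _ _ gK.
by rewrite -(rcoset_Aut_set gI) // reps_isometry.
Qed.

Lemma reps_transl d1 d2 w : d1 \in D -> d2 \in D ->
  d1 @: U = translate w (d2 @: U) -> exists w', forall x, d1 x = w' + d2 x.
Proof.
move=> D1 D2 E; have [_ _ D_tau] := repsD; apply: D_tau => //.
exists (affine_perm w 1); first by apply/is_translationP; exists w.
rewrite -rcosetM; apply/rcoset_eqP; rewrite rcoset_Aut_set ?(reps_isometry D1) //.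
  rewrite imset_permM eq_sym E; apply/eqP/eq_imset => x; exact/esym/affine_perm1E.
by rewrite groupM ?(reps_isometry D2) // affine_perm_isometry.
Qed.

(** Every element of [Aut_set K] factors uniquely as an automorphism of [U] followed by a
    representative. *)
Lemma reps_card : Aut_set U \subset Aut_set K -> (#|D| * #|Aut_set U|)%N = #|Aut_set K|.
Proof.
move=> /subsetP UK; rewrite -cardsX -(card_in_imset (f := fun e => (e.2 * e.1)%g)).
  apply: eq_card => g; apply/imsetP/idP => [[[d b]]|gK].
    rewrite in_setX /= => /andP[dD bU] ->; rewrite groupM //; first exact: UK.
    by case: repsD => /subsetP DK _ _; apply: DK.
  have [d dD dg] := reps_exists gK.
  exists (d, (g * d^-1)%g); last by rewrite /= mulgKV.
  have [gI _] := Aut_setP _ _ gK.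
  by rewrite in_setX /= dD -mem_rcoset rcoset_Aut_set ?dg ?eqxx ?(reps_isometry dD).
move=> [d b] [d' b']; rewrite !in_setX /= => /andP[dD bU] /andP[d'D b'U] E.
have dd : d = d'.
  have img e c : c \in Aut_set U -> (c * e)%g @: U = e @: U.
    by case/Aut_setP => _ cU; rewrite imset_permM cU.
  by apply: reps_inj => //; rewrite -(img _ _ bU) E img.
by rewrite dd in E *; rewrite (mulIg _ _ _ E).
Qed.

(** A functional vanishing on [U] is constant on [S']; transported through the common image it is
    constant on [S], hence vanishes on [U] again. As [U] is its own double annihilator, the
    permutation parts of [d] and [d'] carry [U] to the same space, and a common point makes the
    images of [U] equal. *)
Lemma reps_full_inj S S' d d' : perp_closed U -> full U S -> full U S' ->
  d \in D -> d' \in D -> d @: S = d' @: S' -> d = d'.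
Proof.
move=> Upp [Sn0 SU Sfull] [_ S'U S'full] dD d'D E; apply: reps_inj => //.
have [p dE] := reps_affine dD; have [p' d'E] := reps_affine d'D.
move: (d 0) (d' 0) dE d'E => v v' dE d'E.
have dd' s : s \in S -> exists2 s', s' \in S' & d s = d' s'.
  move=> sS; have : d s \in d' @: S' by rewrite -E imset_f.
  by case/imsetP => s'; exists s'.
have pp' u : u \in U -> col_perm p'^-1 (col_perm p u) \in U.
  move=> uU; apply: Upp => a aU.
  rewrite dot_col_perm invgK dot_col_perm.
  apply: (Sfull _ (dot (col_perm p' a) (v + v'))) uU => s sS.
  rewrite -dot_col_perm; have [s' s'S] := dd' s sS.
  rewrite dE d'E !affine_permE => Es.
  have -> : col_perm p s = v + v' + col_perm p' s'.
    by rewrite -addrA -Es word_addKx.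
  rewrite dotDr [X in _ + X](_ : _ = 0) ?addr0 //.
  by rewrite dotC dot_col_perm col_permK dotC aU // (subsetP S'U).
apply/eqP; rewrite eqEcard !card_imset ?leqnn ?andbT; try exact: perm_inj.
apply/subsetP => _ /imsetP[u uU ->].
have /set0Pn[s sS] := Sn0; have [s' s'S] := dd' s sS => Es.
have sU := subsetP SU _ sS.
apply/imsetP; exists (s' + col_perm p'^-1 (col_perm p (s + u))).
  by rewrite (linear_add _ linU (subsetP S'U _ s'S)) pp' // (linear_add _ linU).
rewrite [in RHS]d'E affine_perm_diff -d'E -Es col_permKV dE.
by rewrite -affine_perm_diff word_addKx.
Qed.

Hypothesis U2 : index2 U K.

Lemma full_glue V W (d : word n -> {perm word n}) (S : word n -> {set word n}) :
  linear_set V -> linear_set W -> V \subset W -> K \subset W ->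
  (forall u, u \in W -> exists2 r, r \in V & r + u \in K) ->
  (forall r, r \in V -> d r \in D) -> (forall r, r \in V -> full U (S r)) ->
  ~ degenerate V d -> full W (\bigcup_(r in V) translate r (d r @: S r)).
Proof.
move=> linV linW VW KW Wdec dD Sfull Ndeg; have [UK UU] := U2.
have V0 : 0 \in V by case: linV.
have memS r s : r \in V -> s \in S r ->
    r + d r s \in \bigcup_(r in V) translate r (d r @: S r).
  move=> rV sS; apply/bigcupP; exists r => //.
  by rewrite mem_translate word_addKx imset_f.
have SK r s : r \in V -> s \in S r -> d r s \in K.
  move=> rV sS; rewrite reps_mem ?dD //; apply: (subsetP UK).
  by have [_ /subsetP SU _] := Sfull r rV; apply: SU.
split.
- have [/set0Pn[s sS] _ _] := Sfull _ V0.
  by apply/set0Pn; exists (0 + d 0 s); apply: memS.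
- apply/subsetP => x /bigcupP[r rV]; rewrite mem_translate => /imsetP[s sS E].
  rewrite -(linear_add _ linW (subsetP VW _ rV)) E.
  exact/(subsetP KW)/SK.
move=> a c ac u uW.
(* The pull-back of [a] along the permutation part of [d r] is constant on [S r], so fullness of
   [S r] makes it vanish on [U]. *)
have H1 r x : r \in V -> x \in U -> dot a (d r x) = dot a (d r 0).
  move=> rV xU; have [p dE] := reps_affine (dD _ rV).
  have [_ _ Srf] := Sfull _ rV.
  rewrite dE -[x]add0r affine_perm_diff -dE dotDr dot_col_perm.
  rewrite (Srf _ (c + dot a (r + d r 0)) _ x xU) ?addr0 // => s sS.
  rewrite -(ac (r + d r s)); last exact: memS.
  rewrite -dot_col_perm -dotDr; congr dot.
  rewrite [in d r s]dE -{2}[s]add0r affine_perm_diff -dE [RHS]addrC !addrA.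
  by rewrite [_ + r]addrC addrA word_addxx add0r word_addxx add0r.
have H5 r : r \in V -> dot a r + dot a (d r 0) = c.
  move=> rV; have [/set0Pn[s sS] SU _] := Sfull _ rV.
  by rewrite -(H1 r s rV (subsetP SU _ sS)) -dotDr ac // memS.
case: (pickP [pred k in K | dot a k != 0]) => [k0 /= /andP[k0K /F2_neq0 ak0]|aK].
  (* The direction of [d r @: U] is the kernel of [a] on [K]. *)
  case: Ndeg; have H2 r x : r \in V ->
      (x \in d r @: U) = (x \in K) && (dot a x == dot a (d r 0)).
    move=> rV; have [p dE] := reps_affine (dD _ rV).
    apply/imsetP/andP => [[y yU ->]|[xK /eqP ax]].
      by rewrite H1 // reps_mem ?dD // (subsetP UK).
    have [y xE] : exists y, x = d r y by exists ((d r)^-1%g x); rewrite permKV.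
    exists y => //; rewrite xE reps_mem ?dD // in xK; apply/negPn/negP => yU.
    (* [y0] is a point of [K] outside [U]; a second such point [y] would give [y + y0] in [U]
       although [a] takes the wrong value there. *)
    have [y0 y0E] : exists y0, k0 + d r 0 = d r y0.
      by exists ((d r)^-1%g (k0 + d r 0)); rewrite permKV.
    have y0K : y0 \in K.
      by rewrite -(reps_mem _ (dD _ rV)) -y0E linear_add // reps_mem ?dD //; case: linK.
    have y0U : y0 \notin U.
      apply/negP => /(H1 r _ rV); rewrite -y0E dotDr ak0.
      by case: (F2_cases (dot a (d r 0))) => ->.
    have /(H1 r _ rV) := UU _ _ xK y0K yU y0U.
    have -> : d r (y + y0) = d r y + k0.
      rewrite dE affine_perm_diff -dE; congr (_ + _).
      have : d r y0 = d r 0 + col_perm p y0 by rewrite -affine_permE -dE.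
      by rewrite -y0E [RHS]addrC => /addIr.
    by rewrite dotDr ak0 -xE ax; case: (F2_cases (dot a (d r 0))) => ->.
  have dE r : r \in V -> forall x, d r x = d r 0 + d 0 0 + d 0 x.
    move=> rV; have [|w wE] := reps_transl (w := d r 0 + d 0 0) (dD _ rV) (dD _ V0).
      apply/setP => x; rewrite mem_translate !H2 // linear_add //.
        rewrite !dotDr; case: (F2_cases (dot a x)) (F2_cases (dot a (d r 0)))
          (F2_cases (dot a (d 0 0))) => [] -> [] -> [] ->; by [].
      by apply: linK.2; rewrite reps_mem ?dD //; case: linK.
    by move=> x; rewrite !wE word_addxK.
  have [p d0E] := reps_affine (dD _ V0).
  exists p, (fun r => d r 0); split=> [r rV x|].
    have -> : col_perm p x = d 0 0 + d 0 x.
      by rewrite [in d 0 x]d0E affine_permE word_addKx.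
    by rewrite dE // addrA.
  (* By [F0] and [F1], [F r] depends only on the bit [dot a r] and is 0 when this bit is 0; hence
     [F] is additive. *)
  pose F r := d r 0 + d 0 0.
  have F0 r : r \in V -> dot a r = 0 -> F r = 0.
    move=> rV ar; apply/eqP; rewrite word_eq_add; apply/eqP.
    have := H5 r rV; rewrite -(H5 0) // ar dot0r => /addrI E.
    by congr (fun_of_perm _ 0); apply: reps_inj; rewrite ?dD //; apply/setP => x; rewrite !H2 // E.
  have F1 r r' : r \in V -> r' \in V -> dot a r = dot a r' -> F r = F r'.
    move=> rV r'V ar; congr (_ + _).
    have := H5 r rV; rewrite -(H5 r') // ar => /addrI E.
    by congr (fun_of_perm _ 0); apply: reps_inj; rewrite ?dD //; apply/setP => x; rewrite !H2 // E.
  have -> : [set r + d r 0 | r in V] = translate (d 0 0) [set r + F r | r in V].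
    by rewrite /translate -imset_comp; apply: eq_imset => r /=; rewrite [RHS]addrCA /F [d 0 0 + _]addrC word_addxK.
  apply: linear_set_affine; split=> [|_ _ /imsetP[r rV ->] /imsetP[r' r'V ->]].
    by apply/imsetP; exists 0; rewrite // F0 ?dot0r ?addr0.
  have rr'V : r + r' \in V by apply: linV.2.
  apply/imsetP; exists (r + r') => //; rewrite addrACA; congr (_ + _).
  case: (F2_cases (dot a r)) (F2_cases (dot a r')) => ar [] ar'.
  - by rewrite !F0 ?dotDr ?ar ?ar' ?addr0.
  - by rewrite (F0 r) // add0r; apply: F1; rewrite ?dotDr // ar ar' add0r.
  - by rewrite (F0 r') // addr0; apply: F1; rewrite ?dotDr // ar ar' addr0.
  by rewrite (F1 r r') ?ar ?ar' // word_addxx F0 // dotDr ar ar'; apply/val_inj.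
(* In the remaining case [a] vanishes on [K]; then [H5] makes it vanish on [V], and [W] is
   [V + K]. *)
have {}aK k : k \in K -> dot a k = 0.
  by move=> kK; apply/eqP; have := aK k; rewrite /= kK => /negbT; rewrite negbK.
have c0 : c = 0.
  rewrite -(H5 0) // dot0r add0r aK // reps_mem ?dD //; by case: linK.
have [r rV ruK] := Wdec u uW.
rewrite -[u](word_addKx r) dotDr (aK _ ruK) addr0.
by have := H5 r rV; rewrite c0 (aK (d r 0)) ?addr0 // reps_mem ?dD //; case: linK.
Qed.

End Reps.

(** * The sets of codes *)

Lemma degenerate_ext n (V : {set word n}) g h :
  (forall r, r \in V -> g r = h r) -> degenerate V g -> degenerate V h.
Proof.
move=> gh [p [v [gv aff]]]; exists p, v; split=> // r rV.
by rewrite -gh //; apply: gv.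
Qed.

Section Codes.
Variables (m : nat) (D : nat -> {set {perm word (2 ^ m)}}).
Hypothesis repD : representatives D.
Local Notation W := (word (2 ^ m)).
Implicit Types (t s e : nat) (r : W) (S : {set W}) (rs qs : seq W)
  (g h : seq W -> {perm W}) (T : W -> {set W}).

Lemma representatives_reps t : (0 < t < m)%N ->
  reps (L m t) (U m t) (D t).
Proof.
move=> tm; have tm' : (1 <= t <= m.-1)%N by lia.
have [] := repD tm'; rewrite calA_L // calB_U // => DA D1 Dtau.
split=> // d1 d2 d1D d2D /(Dtau _ _ d1D d2D) [tau [/is_translationP[w ->] _ ->]].
by exists w => x; rewrite permM affine_perm1E.
Qed.

Lemma L_K t : (t.+1 < m)%N -> L m t = K m t.
Proof. by move=> tm; rewrite /L ltn_eqF. Qed.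

Definition glue t T : {set W} := \bigcup_(r in V m t) translate r (T r).

Lemma glue_ext t T T' : (forall r, r \in V m t -> T r = T' r) -> glue t T = glue t T'.
Proof. by move=> TT'; apply: eq_bigr => r /TT' ->. Qed.

(** Distinct elements of [V t] lie in distinct cosets of [K (t - 1)], so each piece is the part of
    the union in its own coset. *)
Lemma glue_inj t T T' : (0 < t <= m)%N ->
  (forall r, r \in V m t -> T r \subset K m t.-1) ->
  (forall r, r \in V m t -> T' r \subset K m t.-1) ->
  glue t T = glue t T' -> forall r, r \in V m t -> T r = T' r.
Proof.
move=> tm; suff part T1 r : (forall r, r \in V m t -> T1 r \subset K m t.-1) ->
    r \in V m t -> T1 r = [set x in K m t.-1 | r + x \in glue t T1].
  by move=> TK T'K E r rV; rewrite (part T) // (part T') // E.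
move=> TK rV; apply/setP => x; rewrite in_set; apply/idP/andP => [xT|[xK]].
  split; first exact: subsetP (TK _ rV) _ xT.
  by apply/bigcupP; exists r; rewrite ?mem_translate ?word_addKx.
case/bigcupP => r' r'V; rewrite mem_translate => xT.
suff rr' : r = r' by move: xT; rewrite rr' word_addKx.
apply/eqP; rewrite -word_eq_add; apply/eqP.
apply: (V_cap_K tm); first by case: (V_linear tm) => _; apply.
rewrite -(linear_add _ (K_linear m t.-1) xK) addrC [r + r']addrC -addrA.
exact: subsetP (TK _ r'V) _ xT.
Qed.

(** Collections indexed by [V m t] are finite functions with the default value 1 outside it, so that
    they can be counted and compared as functions. *)
Definition colls t : {set {ffun W -> {perm W}}} :=
  [set d in pffun_on 1%g (mem (V m t)) (mem (D t.-1)) | `[< ~ degenerate (V m t) d >]].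

Definition glue_pair t (dS : {ffun W -> {perm W}} * {ffun W -> {set W}}) :=
  glue t (fun r => dS.1 r @: dS.2 r).

(** The possible sets of level [t], built from the bottom up without index sequences, so that their
    number satisfies a recursion. *)
Fixpoint codes t : {set {set W}} :=
  match t with
  | 0 => set0
  | 1 => [set V m 1]
  | t'.+1 => [set glue_pair t dS | dS in
      setX (colls t) [set S : {ffun W -> {set W}}
        | S \in pffun_on set0 (mem (V m t)) (mem (codes t'))]]
  end.

Lemma collsP t (d : {ffun W -> {perm W}}) : d \in colls t ->
  [/\ forall r, r \in V m t -> d r \in D t.-1, forall r, r \notin V m t -> d r = 1%g
    & ~ degenerate (V m t) d].
Proof.
rewrite inE => /andP[/pffun_onP[supp im] /asboolP nd]; split=> // r rV.
  by apply: im; apply: image_f.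
by apply/eqP/(contraNT _ rV) => dr; apply: (subsetP supp).
Qed.

Lemma codes_glueP t S : S \in codes t.+2 -> exists d (C' : {ffun W -> {set W}}),
  [/\ d \in colls t.+2, forall r, r \in V m t.+2 -> C' r \in codes t.+1,
     forall r, r \notin V m t.+2 -> C' r = set0 &
     S = glue t.+2 (fun r => d r @: C' r)].
Proof.
case/imsetP => -[d C']; rewrite in_setX /= [X in _ && X]in_set => /andP[dc /pffun_onP[supp im]] ->.
exists d, C'; split=> // r rV; first by apply: im; apply: image_f.
by apply/eqP/(contraNT _ rV) => dr; apply: (subsetP supp).
Qed.

Lemma mem_codes_glue t (d : W -> {perm W}) T :
  (forall r, r \in V m t.+2 -> d r \in D t.+1) -> ~ degenerate (V m t.+2) d ->
  (forall r, r \in V m t.+2 -> T r \in codes t.+1) ->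
  glue t.+2 (fun r => d r @: T r) \in codes t.+2.
Proof.
move=> dD nd Tc; apply/imsetP.
exists ([ffun r => if r \in V m t.+2 then d r else 1%g],
        [ffun r => if r \in V m t.+2 then T r else set0]); last first.
  by apply: glue_ext => r rV; rewrite /= !ffunE rV.
rewrite in_setX /= [X in X && _]in_set [X in _ && X]in_set; apply/andP; split.
  apply/andP; split; last first.
    apply/asboolP => dg; apply: nd; apply: degenerate_ext dg => r rV.
    by rewrite ffunE rV.
  apply/pffun_onP; split.
    by apply/subsetP => r; rewrite inE ffunE; case: ifP => //; rewrite eqxx.
  by move=> _ /imageP[r rV ->]; rewrite ffunE rV dD.
apply/pffun_onP; split.
  by apply/subsetP => r; rewrite inE ffunE; case: ifP => //; rewrite eqxx.
by move=> _ /imageP[r rV ->]; rewrite ffunE rV Tc.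
Qed.

(** The only code of level 1 is [U 1] itself; [full_glue] raises the level by one. *)
Lemma codes_full t S : (0 < t < m)%N -> S \in codes t -> full (U m t) S.
Proof.
elim: t S => // t IH S tm; case: t IH tm => [_ m1|t IH tm].
  by move=> /set1P ->; rewrite V1 ?(ltnW m1) //; apply/linear_full/U_linear.
case/codes_glueP => d [C' [/collsP[dD _ nd] C'c _ ->]].
have tm' : (0 < t.+2 <= m)%N by lia.
have t1 : (0 < t.+1 < m)%N by lia.
have rD := representatives_reps t1; rewrite L_K in rD; last by lia.
apply: (full_glue (K_linear m t.+1) rD (U_index2 m t.+1) (V := V m t.+2) (d := d) (S := C')) => //.
- exact: V_linear.
- exact: U_linear.
- exact: V_sub_U.
- exact: (K_pred_sub (t := t.+2)).
- by move=> u /(U_decomp tm').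
by move=> r rV; apply: IH => //; apply: C'c.
Qed.

Lemma image_sub_K t d S : (t.+1 < m)%N -> (0 < t)%N -> d \in D t -> S \in codes t ->
  d @: S \subset K m t.
Proof.
move=> tm t0 dD Sc; have t1 : (0 < t < m)%N by lia.
have rD := representatives_reps t1; rewrite L_K in rD; last by lia.
have [_ /subsetP SU _] := codes_full t1 Sc; have [/subsetP UK _] := U_index2 m t.
by apply/subsetP => _ /imsetP[s sS ->]; rewrite (reps_mem rD) ?UK ?SU.
Qed.

Lemma codes_inj t d d' S S' : (0 < t < m)%N -> d \in D t -> d' \in D t ->
  S \in codes t -> S' \in codes t -> d @: S = d' @: S' -> d = d' /\ S = S'.
Proof.
move=> tm dD d'D Sc S'c E.
have dd' : d = d'.
  exact: (reps_full_inj (U_linear m t) (representatives_reps tm) (@U_perp_closed m t)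
    (codes_full tm Sc) (codes_full tm S'c) dD d'D E).
split=> //; apply: (imset_inj (@perm_inj _ d)); by rewrite E dd'.
Qed.

(** Gluing is injective: cosets separate the pieces, and [codes_inj] splits each piece into its
    isometry and its code. *)
Lemma card_codes t : (t.+2 < m)%N ->
  #|codes t.+2| = (#|colls t.+2| * #|codes t.+1| ^ #|V m t.+2|)%N.
Proof.
move=> tm; have tm' : (0 < t.+2 <= m)%N by lia.
have t1 : (0 < t.+1 < m)%N by lia.
rewrite card_in_imset ?cardsX; last first.
  move=> [d C1] [d' C1'] /= ; rewrite !in_setX /= ![_ \in [set _ in pffun_on _ _ _]]in_set.
  move=> /andP[/collsP[dD d1 _] /pffun_onP[suppC imC]].
  move=> /andP[/collsP[d'D d'1 _] /pffun_onP[suppC' imC']] E.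
  have C1c r : r \in V m t.+2 -> C1 r \in codes t.+1 by move=> rV; apply/imC/image_f.
  have C1'c r : r \in V m t.+2 -> C1' r \in codes t.+1 by move=> rV; apply/imC'/image_f.
  have dC r : r \in V m t.+2 -> d r = d' r /\ C1 r = C1' r.
    move=> rV; apply: (codes_inj t1 (dD _ rV) (d'D _ rV) (C1c _ rV) (C1'c _ rV)).
    apply: (glue_inj tm' _ _ E) => // r' r'V; apply: image_sub_K => //.
    - exact: dD.
    - exact: C1c.
    - exact: d'D.
    exact: C1'c.
  congr pair; apply/ffunP => r; case: (boolP (r \in V m t.+2)) => rV.
  - by case: (dC r rV).
  - by rewrite d1 // d'1.
  - by case: (dC r rV).
  have suppE (F : {ffun W -> {set W}}) : set0.-support F \subset mem (V m t.+2) -> F r = set0.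
    move=> supp; apply/eqP/(contraNT _ rV) => Fr; exact: (subsetP supp).
  by rewrite !suppE.
congr muln; rewrite -(card_pffun_on set0); apply: eq_card => f; exact: in_set.
Qed.

(** * Families of isometries and their codes *)

Definition index_upto e s qs : bool :=
  (size qs == e - s)%N && all (fun i => qs`_i \in V m (s + i)) (iota 0 (e - s)).

Lemma index_upto_cons e s r qs : (s < e)%N ->
  index_upto e s (r :: qs) = (r \in V m s) && index_upto e s.+1 qs.
Proof.
move=> se; rewrite /index_upto -(subnSK se) /= eqSS addn0.
rewrite andbCA; congr (_ && (_ && _)).
rewrite (iotaDl 1 0) all_map; apply: eq_all => i /=.
by rewrite addnA addn1.
Qed.

Lemma index_upto_rcons e s r qs : (s <= e)%N ->
  index_upto e.+1 s (rcons qs r) = (r \in V m e) && index_upto e s qs.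
Proof.
move=> se; rewrite /index_upto size_rcons subSn // eqSS andbCA.
case: eqP => // sz; rewrite -(addn1 (e - s)) iotaD all_cat /= andbT add0n.
rewrite nth_rcons sz ltnn eqxx subnKC // andbC; congr andb.
apply: eq_in_all => i; rewrite mem_iota /= add0n => ie.
by rewrite nth_rcons sz ie.
Qed.

(** The conditions on a family with top level [e] instead of [m], prescribing nothing at the empty
    sequence; such partial families are the ones assembled recursively. *)
Definition family_upto e g :=
  (forall s qs, (1 < s < e)%N -> index_upto e s qs -> g qs \in D s.-1) /\
  (forall s qs, (1 < s < e)%N -> index_upto e s.+1 qs ->
     ~ degenerate (V m s) (fun r => g (r :: qs))).

Lemma A_family_glue g t rs :
  A_family g t.+2 rs = glue t.+2 (fun r => g (r :: rs) @: A_family g t.+1 (r :: rs)).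
Proof. by []. Qed.

Lemma A_family_codes g t rs : is_family D g -> (0 < t < m)%N -> is_index t.+1 rs ->
  A_family g t rs \in codes t.
Proof.
move=> [gD gnd]; elim: t rs => // t IH rs tm; case: t IH tm => [_ _ _|t IH tm irs].
  exact/set1P.
have irrs r : r \in V m t.+2 -> is_index t.+2 (r :: rs).
  by move=> rV; rewrite -[is_index _ _]/(index_upto m t.+2 _) index_upto_cons ?rV //; lia.
rewrite A_family_glue; apply: mem_codes_glue => [r rV||r rV].
- by apply: (gD t.+2); [lia | apply: irrs].
- by apply: gnd => //; lia.
by apply: IH; [lia | apply: irrs].
Qed.

Lemma A_family_rcons g h r s qs : (forall q, q != [::] -> g (rcons q r) = h q) ->
  A_family g s (rcons qs r) = A_family h s qs.
Proof.
move=> gh; elim: s qs => // s IH qs; case: s IH => // s IH.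
by rewrite !A_family_glue; apply: glue_ext => r' _; rewrite -rcons_cons IH gh.
Qed.

Lemma A_family_ext g h s qs : (forall q, q != [::] -> g q = h q) ->
  A_family g s qs = A_family h s qs.
Proof.
move=> gh; elim: s qs => // s IH qs; case: s IH => // s IH.
by rewrite !A_family_glue; apply: glue_ext => r' _; rewrite IH gh.
Qed.

(** Every piece of the code has its own family by induction; these are merged into one family whose
    index has one more entry. *)
Lemma codes_family t S : S \in codes t ->
  exists2 g, A_family g t [::] = S & family_upto t.+1 g.
Proof.
elim: t S => [S|t IH S]; first by rewrite inE.
case: t IH => [_ /set1P ->|t IH].
  by exists (fun=> 1%g) => //; split=> s qs; lia.
case/codes_glueP => d [C' [/collsP[dD _ nd] C'c _ SE]].
have [G GP] : exists G : W -> seq W -> {perm W}, forall r, r \in V m t.+2 ->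
    A_family (G r) t.+1 [::] = C' r /\ family_upto t.+2 (G r).
  have /choice[G GP] : forall r, exists Gr : seq W -> {perm W}, r \in V m t.+2 ->
      A_family Gr t.+1 [::] = C' r /\ family_upto t.+2 Gr.
    move=> r; case: (boolP (r \in V m t.+2)) => rV; last by exists (fun=> 1%g).
    by have [Gr] := IH _ (C'c r rV); exists Gr.
  by exists G.
(* The last entry of an index belongs to the top level and selects the piece; the other entries are
   an index of the family of that piece, and if there are none the value comes from [d]. *)
pose g qs := match rev qs with
             | [::] => 1%g
             | r :: b => if b is [::] then d r else G r (rev b)
             end.
have g1 r : g [:: r] = d r by [].
have gE r b : b != [::] -> g (rcons b r) = G r b.
  rewrite /g rev_rcons; case/lastP: b => // b x _.
  by rewrite rev_rcons -rev_rcons revK.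
exists g.
  rewrite SE A_family_glue; apply: glue_ext => r rV; rewrite g1.
  by rewrite -[[:: r]]/(rcons [::] r) (A_family_rcons _ _ (gE r)) (GP r rV).1.
split=> s qs /andP[s1 st].
  case/lastP: qs => [|b r]; first by rewrite /index_upto eq_sym subn_eq0 leqNgt st.
  rewrite index_upto_rcons // => /andP[rV ib].
  case: (ltngtP s t.+2) => ss.
  - rewrite gE; first by apply: (GP r rV).2.1 => //; rewrite s1.
    case: b ib => //; by rewrite /index_upto eq_sym subn_eq0 leqNgt ss.
  - by lia.
  move: ib; rewrite ss /index_upto subnn => /andP[/nilP -> _].
  by rewrite g1 dD.
case: (ltngtP s t.+2) => ss; [|by lia|]; last first.
  by rewrite ss /index_upto subnn => /andP[/nilP -> _].
case/lastP: qs => [|b r]; first by rewrite /index_upto eq_sym subn_eq0 ltnNge ss.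
rewrite index_upto_rcons // => /andP[rV ib] dg.
apply: ((GP r rV).2.2 s b _ ib); first by rewrite s1.
by apply: degenerate_ext dg => r' _; rewrite -rcons_cons gE.
Qed.

Hypothesis m1 : (1 < m)%N.

Lemma family_codes : [set S : {set W} | `[< exists2 g, is_family D g & S = C g >]] =
  [set (dS : {perm W} * {set W}).1 @: dS.2 | dS in setX (D m.-1) (codes m.-1)].
Proof.
apply/setP => S; rewrite in_set; apply/asboolP/imsetP => [[g gF ->]|[[d S']]].
  exists (g [::], A_family g m.-1 [::]) => //; rewrite in_setX /=.
  have mm : is_index m ([::] : seq W) by rewrite /is_index subnn.
  rewrite gF.1 ?m1 ?leqnn //=; apply: A_family_codes => //; first by lia.
  by rewrite prednK // ltnW.
rewrite in_setX /= => /andP[dD /codes_family[g <- [gD gnd]]] ->.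
rewrite prednK in gD gnd; last by lia.
exists (fun qs => if qs is [::] then d else g qs); last first.
  by rewrite /C -(@A_family_ext g) // => -[].
split=> s rs sm irs.
  case: (ltngtP s m) => sm'; last first.
  - by move: irs; rewrite sm' /is_index subnn => /andP[/nilP ->].
  - by lia.
  case: rs irs => [|r rs]; first by rewrite /is_index eq_sym subn_eq0 leqNgt sm'.
  by move=> irs; apply: gD => //; lia.
by apply: gnd => //; lia.
Qed.

Lemma card_K_LA : K_LA D = (#|D m.-1| * #|codes m.-1|)%N.
Proof.
rewrite /K_LA family_codes card_in_imset ?cardsX // => -[d S] [d' S'].
rewrite !in_setX /= => /andP[dD Sc] /andP[d'D S'c] E.
have [|-> ->//] := codes_inj _ dD d'D Sc S'c E; by lia.
Qed.

(** Descent from the top level: equal images give equal isometries and equal sets by [codes_inj],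
    and [glue_inj] passes the equality to the pieces one level below. *)
Lemma family_unique g h : is_family D g -> is_family D h -> C g = C h ->
  forall t rs, (2 <= t <= m)%N -> is_index t rs -> g rs = h rs.
Proof.
move=> gF hF CE.
suff main k t rs : (2 <= t <= m)%N -> (m - t = k)%N -> is_index t rs ->
    g rs @: A_family g t.-1 rs = h rs @: A_family h t.-1 rs ->
    g rs = h rs /\ A_family g t.-1 rs = A_family h t.-1 rs.
  suff imE k t rs : (2 <= t <= m)%N -> (m - t = k)%N -> is_index t rs ->
      g rs @: A_family g t.-1 rs = h rs @: A_family h t.-1 rs.
    by move=> t rs tm irs; case: (main _ t rs tm erefl irs) => //; apply: imE irs.
  elim: k t rs => [|k IH] t rs tm mt irs.
    have mt' : t = m by lia.
    by move: irs; rewrite mt' /is_index subnn => /andP[/nilP -> _]; apply: CE.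
  case: rs irs => [|r rs]; first by rewrite /is_index mt.
  have tm' : (2 <= t.+1 <= m)%N by lia.
  rewrite -[is_index _ _]/(index_upto m t _) index_upto_cons; last by lia.
  move=> /andP[rV irs]; have mt' : (m - t.+1 = k)%N by lia.
  have [_ /=] := main _ _ rs tm' mt' irs (IH _ rs tm' mt' irs).
  case: t tm mt rV irs tm' mt' => [|[|t]] // tm mt rV irs tm' mt'.
  have sub f r' : is_family D f -> r' \in V m t.+2 ->
      f (r' :: rs) @: A_family f t.+1 (r' :: rs) \subset K m t.+1.
    move=> fF r'V; have irs' : is_index t.+2 (r' :: rs).
      by rewrite -[is_index _ _]/(index_upto m t.+2 _) index_upto_cons ?r'V //; lia.
    have t3 : (t.+2 < m)%N by lia.
    apply: (image_sub_K t3 (ltn0Sn t)); first by apply: (fF.1 t.+2).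
    by apply: A_family_codes => //; lia.
  have t2 : (0 < t.+2 <= m)%N by lia.
  rewrite !A_family_glue => E; apply: (glue_inj t2 _ _ E) => // r'; exact: sub.
move=> tm _ irs; have tt : (0 < t.-1 < m)%N by lia.
apply: (codes_inj tt); [exact: gF.1 irs | exact: hF.1 irs | |];
  by apply: A_family_codes; rewrite ?prednK //; lia.
Qed.

End Codes.

(** * Degenerate collections *)

(** Linear functionals on [V], extended by 0 so that they form a finite set. *)
Definition functionals n (V : {set word n}) : {set {ffun word n -> 'F_2}} :=
  [set f : {ffun word n -> 'F_2} |
    [forall r, (r \notin V) ==> (f r == 0)] &&
    [forall r in V, forall s in V, f (r + s) == f r + f s]].

Lemma functionalsP n (V : {set word n}) (f : {ffun word n -> 'F_2}) :
  reflect ((forall r, r \notin V -> f r = 0) /\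
           (forall r s, r \in V -> s \in V -> f (r + s) = f r + f s))
          (f \in functionals V).
Proof.
rewrite inE; apply: (iffP andP) => -[f0 fD]; split.
- by move=> r rV; have /forallP/(_ r)/implyP/(_ rV)/eqP := f0.
- by move=> r s rV sV; have /forallP/(_ r)/implyP/(_ rV)/forallP/(_ s)/implyP/(_ sV)/eqP := fD.
- by apply/forallP => r; apply/implyP => rV; rewrite f0.
apply/forallP => r; apply/implyP => rV; apply/forallP => s; apply/implyP => sV.
by rewrite fD.
Qed.

Section Degenerate.
Variables (n : nat) (K U V : {set word n}) (D : {set {perm word n}}).
Hypotheses (linK : linear_set K) (linU : linear_set U) (repsD : reps K U D).
Hypotheses (U2 : index2 U K) (k0 : word n) (k0K : k0 \in K) (k0U : k0 \notin U).
Hypotheses (linV : linear_set V) (VK : forall r, r \in V -> r \in K -> r = 0).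
Implicit Types (d e : {perm word n}) (r s x y w : word n).

Lemma affine_addE d v p x y : d = affine_perm v p -> d (x + y) = d x + col_perm p y.
Proof. by move=> ->; apply: affine_perm_diff. Qed.

Lemma reps_shift d e w : d \in D -> e \in D -> (forall x, e x = w + d x) ->
  exists2 y, y \in K & forall x, e x = d (x + y).
Proof.
move=> dD eD ed; have [p dE] := reps_affine repsD dD.
have K0 : 0 \in K by case: linK.
exists (col_perm p^-1 w) => [|x]; last first.
  by rewrite ed (affine_addE _ _ dE) col_permKV addrC.
rewrite -(reps_mem repsD _ dD) -[col_perm _ _]add0r (affine_addE _ _ dE) col_permKV.
by rewrite addrC -ed (reps_mem repsD).
Qed.

Lemma shift_imset d e y : (forall x, e x = d (x + y)) -> e @: U = d @: translate y U.
Proof.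
move=> ed; rewrite /translate -imset_comp; apply: eq_imset => x /=.
by rewrite ed addrC.
Qed.

Lemma shift_eq d e y : d \in D -> e \in D -> y \in U ->
  (forall x, e x = d (x + y)) -> e = d.
Proof.
move=> dD eD yU /shift_imset E; apply: (reps_inj repsD) => //.
by rewrite E translate_linear.
Qed.

Lemma shift_eq2 d e e' y y' : d \in D -> e \in D -> e' \in D ->
  y \in K -> y' \in K -> y \notin U -> y' \notin U ->
  (forall x, e x = d (x + y)) -> (forall x, e' x = d (x + y')) -> e = e'.
Proof.
move=> dD eD e'D yK y'K yU y'U /shift_imset E /shift_imset E'.
apply: (reps_inj repsD) => //; rewrite E E'.
have [_ UU] := U2; have yy'U : y + y' \in U by apply: UU.
by rewrite -[y'](word_addKx y) translateD (translate_linear linU yy'U).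
Qed.

(** Precomposing [d] with the shift by [k0] gives an element of [Aut_set K] in another coset. The
    image of [U] is only translated, so its representative [e] keeps the permutation part of [d]; a
    shift [y] in [U] would force [e = d] and put [k0] in [U]. *)
Lemma reps_partner d : d \in D -> exists e y,
  [/\ e \in D, y \in K, y \notin U & forall x, e x = d (x + y)].
Proof.
move=> dD; have [p dE] := reps_affine repsD dD; have [DK _ _] := repsD.
have K0 : 0 \in K by case: linK.
have : affine_perm (d 0) p \in Aut_set K by rewrite -dE; apply: (subsetP DK).
move=> /(Aut_linearP _ _ linK)[_ pK].
pose g := affine_perm (d 0 + col_perm p k0) p.
have gd x : g x = d (x + k0).
  rewrite affine_permE (affine_addE _ _ dE) -addrA [col_perm p k0 + _]addrC addrA.
  by congr (_ + _); rewrite -affine_permE -dE.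
have gK : g \in Aut_set K.
  apply/Aut_linearP => //; split=> //.
  by rewrite linear_add // ?pK // (reps_mem repsD).
have [e eD eU] := reps_exists repsD gK.
have [|w wE] := reps_transl repsD (w := col_perm p k0) eD dD.
  rewrite eU /translate -imset_comp; apply: eq_imset => x /=.
  by rewrite gd (affine_addE _ _ dE) addrC.
have [y yK ed] := reps_shift dD eD wE; exists e, y; split=> //.
apply/negP => yU; have E := shift_eq dD eD yU ed.
have : d 0 \in g @: U by rewrite -eU E imset_f //; case: linU.
case/imsetP => u uU; rewrite gd => /perm_inj/eqP.
by rewrite eq_sym word_eq_add => /eqP uk; case/negP: k0U; rewrite -uk.
Qed.

Definition deg_colls : {set {ffun word n -> {perm word n}}} :=
  [set d in pffun_on 1%g (mem V) (mem D) | `[< degenerate V d >]].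

(** A degenerate collection takes the value [g 0] or its partner [pt (g 0)], the choice being a bit
    depending on [r]; the affine condition says exactly that this bit is a linear functional. *)
Lemma card_deg_colls : #|deg_colls| = (#|D| * #|functionals V|)%N.
Proof.
have V0 : 0 \in V by case: linV.
have VD r s : r \in V -> s \in V -> r + s \in V by case: linV => _; apply.
have K0 : 0 \in K by case: linK.
have [pt ptP] : exists pt : {perm word n} -> {perm word n}, forall d, d \in D ->
    pt d \in D /\ exists y, [/\ y \in K, y \notin U & forall x, pt d x = d (x + y)].
  have /choice[pt ptP] : forall d, exists e, d \in D ->
      e \in D /\ exists y, [/\ y \in K, y \notin U & forall x, e x = d (x + y)].
    move=> d; case: (boolP (d \in D)) => dD; last by exists d.
    by have [e [y [eD yK yU ed]]] := reps_partner dD; exists e => _; split=> //; exists y.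
  by exists pt.
have pt_neq d : d \in D -> pt d != d.
  move=> /ptP[_ [y [_ yU ed]]]; apply: contraNN yU => /eqP E.
  have /perm_inj/eqP : d 0 = d (0 + y) by rewrite -ed E.
  by rewrite add0r eq_sym => /eqP ->; case: linU.
pose q (df : {perm word n} * {ffun word n -> 'F_2}) := [ffun r =>
  if r \in V then if df.2 r == 0 then df.1 else pt df.1 else 1%g].
have f0 (f : {ffun word n -> 'F_2}) : f \in functionals V -> f 0 = 0.
  by case/functionalsP => _ fD; have := fD _ _ V0 V0; rewrite addr0 F2_addxx.
rewrite -cardsX -(card_in_imset (f := q)); last first.
  move=> [d f] [e h]; rewrite !in_setX /= => /andP[dD fF] /andP[eD hF] /ffunP E.
  have de : d = e by have := E 0; rewrite !ffunE V0 /= !f0 // eqxx.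
  subst e; congr pair; apply/ffunP => r.
  have /functionalsP[fN _] := fF; have /functionalsP[hN _] := hF.
  case: (boolP (r \in V)) => rV; last by rewrite fN // hN.
  have := E r; rewrite !ffunE rV /=; have := pt_neq d dD.
  case: (F2_cases (f r)) (F2_cases (h r)) => [] -> [] -> //=;
  by move=> /eqP N E'; case: N.
apply: eq_card => g; apply/idP/imsetP => [|[[d f]]]; last first.
  rewrite in_setX /= => /andP[dD fF] ->; have [ptD [y [yK yU yE]]] := ptP d dD.
  have /functionalsP[fN fD] := fF.
  rewrite in_set; apply/andP; split.
    apply/pffun_onP; split.
      by apply/subsetP => r; rewrite inE ffunE; case: ifP => //; rewrite eqxx.
    by move=> _ /imageP[r rV ->]; rewrite ffunE rV /=; case: ifP.
  apply/asboolP; have [p dE] := reps_affine repsD dD.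
  pose F r := if f r == 0 then 0 else col_perm p y.
  exists p, (fun r => d 0 + F r); split=> [r rV x|].
    rewrite ffunE rV /= /F; case: ifP => _.
      by rewrite addr0 -affine_permE -dE.
    by rewrite yE (affine_addE _ _ dE) addrAC; congr (_ + _); rewrite -affine_permE -dE.
  have -> : [set r + (d 0 + F r) | r in V] = translate (d 0) [set r + F r | r in V].
    by rewrite /translate -imset_comp; apply: eq_imset => r /=; rewrite addrCA.
  apply: linear_set_affine; split=> [|_ _ /imsetP[r rV ->] /imsetP[s sV ->]].
    by apply/imsetP; exists 0; rewrite // /F f0 // eqxx addr0.
  apply/imsetP; exists (r + s); rewrite ?VD // addrACA; congr (_ + _).
  rewrite /F fD //; case: (F2_cases (f r)) (F2_cases (f s)) => [] -> [] -> /=;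
  by rewrite ?addr0 ?add0r ?word_addxx.
rewrite in_set => /andP[/pffun_onP[supp im] /asboolP[p [v [gv [a [L aff]]]]]].
have gD r : r \in V -> g r \in D by move=> rV; apply/im/image_f.
have gN r : r \notin V -> g r = 1%g.
  by move=> rV; apply/eqP/(contraNT _ rV) => gr; apply: (subsetP supp).
have gE r x : r \in V -> g r x = v r + v 0 + g 0 x.
  by move=> rV; rewrite gv // gv // addrA word_addxK.
have vK r : r \in V -> v r \in K.
  by move=> rV; rewrite -[v r]addr0 -(col_perm0 p) -gv // (reps_mem repsD) ?gD.
have [ptD [y [yK yU yE]]] := ptP _ (gD _ V0).
have gpt r : r \in V -> g r != g 0 -> g r = pt (g 0).
  move=> rV gr; have [z zK zE] := reps_shift (gD _ V0) (gD _ rV) (fun x => gE r x rV).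
  apply: (shift_eq2 (gD _ V0) (gD _ rV) ptD zK yK _ yU zE yE).
  by apply: contraNN gr => zU; apply/eqP; apply: (shift_eq (gD _ V0) (gD _ rV) zU).
pose f : {ffun word n -> 'F_2} := [ffun r => ((r \in V) && (g r != g 0))%:R].
exists (g 0, f); last first.
  apply/ffunP => r; rewrite ffunE /= ffunE; case: (boolP (r \in V)) => rV; last by rewrite gN.
  by case: (boolP (g r == g 0)) => [/eqP //|gr] /=; rewrite gpt.
rewrite in_setX /= gD //; apply/functionalsP; split=> [r rV|r s rV sV].
  by rewrite ffunE (negbTE rV).
have gv0 r1 r2 : r1 \in V -> r2 \in V -> (g r1 == g r2) = (v r1 == v r2).
  move=> r1V r2V; apply/eqP/eqP => [E|E].
    by have := gv r1 r1V 0; rewrite E gv // => /addIr.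
  by apply/permP => x; rewrite !gv // E.
have affV r1 : r1 \in V -> r1 + v r1 - a \in L.
  by move=> r1V; have := imset_f (fun r => r + v r) r1V; rewrite aff inE.
(* Over two elements the sum of three points of an affine space is again a point of it. *)
have : r + v r + (s + v s) + v 0 - a \in L.
  have := memvD (memvD (affV _ rV) (affV _ sV)) (affV _ V0).
  rewrite !word_oppr add0r; congr (_ \in L).
  by rewrite (addrACA (r + v r) a) word_addxx addr0 addrA.
move=> inL.
have : r + v r + (s + v s) + v 0 \in [set r + v r | r in V] by rewrite aff inE.
case/imsetP => z zV E.
have z0 : r + s + z = v r + v s + v 0 + v z.
  have zE : z = r + s + (v r + v s + v 0 + v z).
    by apply/eqP; rewrite [X in _ == X]addrA -word_add_eq -E (addrACA r (v r)) !addrA eqxx.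
  by rewrite {1}zE word_addKx.
(* The difference of the two sides lies in [V], and in [K] because all the [v] values do. *)
have zrs : z = r + s.
  apply/eqP; rewrite eq_sym -word_eq_add; apply/eqP; apply: VK.
    by rewrite !VD.
  rewrite z0; have [_ KD] := linK; by rewrite !KD ?vK.
rewrite zrs word_addxx in z0.
rewrite !ffunE rV sV VD //= !gv0 ?VD //.
have vv r1 : r1 \in V -> v r1 != v 0 -> v r1 = v 0 + (v 0 + pt (g 0) 0).
  by move=> r1V; rewrite -gv0 // => /(gpt _ r1V) <-; rewrite gv // col_perm0 addr0 word_addKx.
have vrs : v (r + s) = v r + v s + v 0.
  by apply/eqP; rewrite eq_sym -word_eq_add -z0.
case: (eqVneq (v r) (v 0)) => vr; case: (eqVneq (v s) (v 0)) => vs /=.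
- by rewrite vrs vr vs word_addxx add0r eqxx addr0.
- by rewrite vrs vr [v 0 + v s]addrC word_addxK vs add0r.
- by rewrite vrs vs word_addxK vr addr0.
by rewrite vrs (vv r rV vr) (vv s sV vs) word_addxx add0r eqxx; apply/val_inj.
Qed.

End Degenerate.

(** * Cardinalities *)

(** Adding a unit word exchanges even and odd words. *)
Lemma card_even_word n : (0 < n)%N -> #|[set v : word n | even_word v]| = (2 ^ n.-1)%N.
Proof.
move=> n0; set E := [set v | _]; pose e := unitw (Ordinal n0).
have Ee x : (e + x \in E) = (x \notin E).
  rewrite !inE !even_wordE sum_addw sum_unitw.
  by case: (F2_cases (\sum_i x 0 i)) => ->.
have cE : #|~: E| = #|E|.
  rewrite -(card_imset E (@addrI _ e)); apply: eq_card => x.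
  rewrite inE; apply/idP/imsetP => [xE|[y yE ->]]; last by rewrite Ee yE.
  by exists (e + x); rewrite ?Ee // word_addKx.
have := cardsC E; rewrite cE card_mx card_Fp // mul1n.
have -> : (2 ^ n = (2 ^ n.-1).*2)%N by rewrite -mul2n -expnS prednK.
by rewrite addnn => /double_inj.
Qed.

Section CardV.
Variables m t : nat.
Hypothesis tm : (0 < t <= m)%N.
Local Notation N := (2 ^ (m - t))%N.
Implicit Types (r s : word (2 ^ m)) (j k : 'I_N).

Lemma twice_inj : injective (@twice m t).
Proof.
move=> v w vw; apply/rowP => j.
by rewrite -!(@twice_lo m t _ (widen_ord (leN tm) j)) // vw.
Qed.

Lemma card_V : #|V m t| = (2 ^ (N.-1))%N.
Proof. by rewrite card_imset ?card_even_word ?pow2_gt0 //; apply: twice_inj. Qed.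

Let z : 'I_N := Ordinal (pow2_gt0 (m - t)).
Let w j : 'I_(2 ^ m) := widen_ord (leN tm) j.
(** For [j != z] these words form a basis of [V t], with the coordinates at [w j] as dual basis. *)
Let eps j : word (2 ^ m) := @twice m t (unitw z + unitw j).

Let epsV j : eps j \in V m t.
Proof.
apply/imsetP; exists (unitw z + unitw j) => //.
by rewrite inE even_wordE sum_addw !sum_unitw.
Qed.

Let epsE j k : k != z -> eps j 0 (w k) = (j == k)%:R.
Proof.
move=> kz; rewrite /eps (@twice_lo m t _ _ k) // mxE !unitwE.
by rewrite eq_sym (negbTE kz) add0r.
Qed.

Let V_eq0 r : r \in V m t -> (forall j, j != z -> r 0 (w j) = 0) -> r = 0.
Proof.
case/imsetP => v; rewrite inE even_wordE => /eqP v0 -> rz.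
have {}rz j : j != z -> v 0 j = 0 by move=> jz; rewrite -(rz j jz) (@twice_lo m t _ _ j).
have vz j : v 0 j = 0.
  case: (eqVneq j z) => [->|/rz//]; rewrite -v0 (bigD1 z) //= big1 ?addr0 //.
apply/rowP => i; rewrite [RHS]mxE; case: (ltnP i N) => iN.
  by rewrite (@twice_lo m t _ _ (Ordinal iN)).
case: (ltnP i N.*2) => i2; last by rewrite twice_supp.
have jN : (i - N < N)%N by lia.
by rewrite (@twice_hi m t _ _ (Ordinal jN)) //= subnK.
Qed.

Let comb (c : 'I_N -> 'F_2) : word (2 ^ m) := \sum_(j | j != z) c j *: eps j.

Let combV c : comb c \in V m t.
Proof.
have [V0 VD] := V_linear tm; apply: (big_ind (fun x => x \in V m t)) => //.
by move=> j _; case: (F2_cases (c j)) => ->; rewrite ?scale0r ?scale1r.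
Qed.

Let comb_coord c k : k != z -> comb c 0 (w k) = c k.
Proof.
move=> kz; rewrite summxE (bigD1 k) //= big1 => [|j /andP[_ jk]].
  by rewrite mxE epsE // eqxx mulr1 addr0.
by rewrite mxE epsE // (negbTE jk) mulr0.
Qed.

Let V_comb r : r \in V m t -> r = comb (fun j => r 0 (w j)).
Proof.
move=> rV; apply/eqP; rewrite -word_eq_add; apply/eqP/V_eq0.
  by case: (V_linear tm) => _; apply; last exact: combV.
by move=> j jz; rewrite mxE comb_coord // F2_addxx.
Qed.

Let functional_comb (f : {ffun word (2 ^ m) -> 'F_2}) c : f \in functionals (V m t) ->
  f (comb c) = \sum_(j | j != z) c j * f (eps j).
Proof.
case/functionalsP => _ fD; have [V0 VD] := V_linear tm.
have f0 : f 0 = 0 by have := fD _ _ V0 V0; rewrite addr0 F2_addxx.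
suff [] : comb c \in V m t /\ f (comb c) = \sum_(j | j != z) c j * f (eps j) by [].
apply: (big_ind2 (fun x y => x \in V m t /\ f x = y)) => [//|x1 y1 x2 y2 [xV <-] [yV <-]|j _].
  by rewrite VD // fD.
by case: (F2_cases (c j)) => ->; rewrite ?scale0r ?scale1r ?mul0r ?mul1r.
Qed.

(** The two copies make [dot] vanish identically on [V t], so the identification with the dual uses
    the coordinates of the first copy other than [z]. *)
Lemma card_functionals_V : #|functionals (V m t)| = #|V m t|.
Proof.
have [V0 VD] := V_linear tm.
pose phi s := [ffun r => if r \in V m t then \sum_(j | j != z) s 0 (w j) * r 0 (w j) else 0]
  : {ffun word (2 ^ m) -> 'F_2}.
rewrite -(card_in_imset (f := phi) (D := V m t)).
  apply: eq_card => f; apply/idP/imsetP => [fF|[s sV ->]].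
    exists (comb (fun j => f (eps j))) => //; apply/ffunP => r.
    rewrite ffunE; case: ifP => rV; last by have [-> //] := functionalsP _ _ fF; rewrite rV.
    rewrite {1}(V_comb rV) functional_comb //; apply: eq_bigr => j jz.
    by rewrite comb_coord // mulrC.
  apply/functionalsP; split=> [r rV|r r' rV r'V]; rewrite !ffunE ?(negbTE rV) //.
  rewrite rV r'V VD // -big_split /=; apply: eq_bigr => j _.
  by rewrite mxE mulrDr.
move=> s s' sV s'V /ffunP E; apply/eqP; rewrite -word_eq_add; apply/eqP/V_eq0.
  exact: VD.
have phiE u k : k != z -> phi u (eps k) = u 0 (w k).
  move=> kz; rewrite ffunE epsV (bigD1 k) //= big1 => [|j /andP[jz jk]].
    by rewrite epsE // eqxx mulr1 addr0.
  by rewrite epsE // eq_sym (negbTE jk) mulr0.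
by move=> j jz; rewrite mxE -!phiE // E F2_addxx.
Qed.

End CardV.

Lemma not_index2_witness m t : (0 < t <= m)%N -> exists2 k, k \in K m t & k \notin U m t.
Proof.
move=> tm; pose i : 'I_(2 ^ m) := Ordinal (pow2_gt0 m).
have [j [ji hji]] := cls_flip i tm; exists (unitw j + unitw i).
  by rewrite cker_unitw ji.
by rewrite U_unitw // clsS // ji eqxx.
Qed.

(** All collections are split into nondegenerate and degenerate ones; the latter are a
    representative together with a functional on [V t.+1]. *)
Lemma card_colls m D t : representatives D -> (0 < t)%N -> (t.+1 < m)%N ->
  (#|@colls m D t.+1| + #|D t| * #|V m t.+1| = #|D t| ^ #|V m t.+1|)%N.
Proof.
move=> repD t0 tm; have t1 : (0 < t < m)%N by lia.
have tm' : (0 < t <= m)%N by lia. have tm2 : (0 < t.+1 <= m)%N by lia.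
have rD := representatives_reps repD t1; rewrite L_K // in rD.
have [k0 k0K k0U] := not_index2_witness tm'.
rewrite -[X in (_ * X)%N](card_functionals_V tm2).
rewrite -(card_deg_colls (K_linear m t) (U_linear m t) rD (U_index2 m t) k0K k0U
  (V_linear tm2) (V_cap_K tm2)).
have -> : (#|D t| ^ #|V m t.+1|)%N =
    #|[set d : {ffun word (2 ^ m) -> {perm word (2 ^ m)}}
       | d \in pffun_on 1%g (mem (V m t.+1)) (mem (D t))]|.
  by rewrite cardsE card_pffun_on.
rewrite -(cardsID [set d : {ffun word (2 ^ m) -> {perm word (2 ^ m)}} | `[< ~ degenerate (V m t.+1) d >]]).
congr addn; apply: eq_card => d; rewrite !in_set //.
by rewrite andbC asbool_neg negbK.
Qed.

(** * Orders of wreath products of symmetric groups *)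

Section Wreath.
Variables (T B : finType) (h : T -> B) (k : nat) (P : {set {perm B}}).
Hypotheses (k0 : (0 < k)%N) (hk : forall b, #|[set x | h x == b]| = k).

(** The wreath product of the symmetric group of a fibre of [h] with the group [P] acting on the
    fibres. *)
Definition lifts : {set {perm T}} :=
  [set p : {perm T} | [exists q in P, forall x, h (p x) == q (h x)]].

(** Numbering the elements of each fibre identifies [T] with the pairs of a fibre and a number below
    [k]; a lift is then a base permutation with one permutation of the numbers for each fibre. *)
Lemma card_lifts : #|lifts| = (k`! ^ #|B| * #|P|)%N.
Proof.
have idx_lt x : (index x (enum [set y | h y == h x]) < k)%N.
  by rewrite -(hk (h x)) cardE index_mem mem_enum inE.
pose io x : 'I_k := Ordinal (idx_lt x).
pose e x := (h x, io x).
have e_inj : injective e.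
  move=> x y [hxy]; rewrite hxy => E.
  have xin : x \in enum [set y0 | h y0 == h y] by rewrite mem_enum inE hxy.
  have yin : y \in enum [set y0 | h y0 == h y] by rewrite mem_enum inE.
  by rewrite -[LHS](nth_index x xin) E nth_index.
have cT : #|T| = (#|B| * k)%N.
  rewrite -sum1_card (partition_big h predT) //= -sum_nat_const.
  by apply: eq_bigr => b _; rewrite -(hk b) sum1dep_card; apply: eq_card => x; rewrite !inE.
have [e' eK e'K] : bijective e by apply: inj_card_bij => //; rewrite card_prod card_ord cT.
have he' b i : h (e' (b, i)) = b by have := e'K (b, i) => -[].
have ie' b i : io (e' (b, i)) = i by have := e'K (b, i) => -[].
pose F (fq : {ffun B -> {perm 'I_k}} * {perm B}) x := e' (fq.2 (h x), fq.1 (h x) (io x)).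
have F_inj fq : injective (F fq).
  move=> x y /(can_inj e'K) [] /perm_inj hxy; rewrite hxy => /perm_inj ixy.
  by apply: e_inj; rewrite /e hxy ixy.
have -> : (k`! ^ #|B| * #|P|)%N = #|setX [set: {ffun B -> {perm 'I_k}}] P|.
  by rewrite cardsX cardsT card_ffun card_Sn.
rewrite -(card_in_imset (f := fun fq => perm (@F_inj fq))).
  apply: eq_card => p; rewrite inE; apply/exists_inP/imsetP => [[q qP /forallP pq]|].
    have {}pq x : h (p x) = q (h x) by apply/eqP.
    have f_inj b : injective (fun i => io (p (e' (b, i)))).
      move=> i j /= E; have : p (e' (b, i)) = p (e' (b, j)).
        by apply: e_inj; rewrite /e E !pq !he'.
      by move/perm_inj/(can_inj e'K) => [].
    exists ([ffun b => perm (@f_inj b)], q); first by rewrite !inE.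
    apply/permP => x; rewrite permE /F /= ffunE permE.
    by rewrite -[(h x, io x)]/(e x) eK -pq; apply/esym/(eK (p x)).
  move=> [[f q]]; rewrite !inE /= => qP ->; exists q => //.
  by apply/forallP => x; rewrite permE /F he'.
move=> [f q] [f' q'] _ _ /permP E; have FE x : F (f, q) x = F (f', q') x.
  by have := E x; rewrite !permE.
have qq : q = q'.
  apply/permP => b; have := FE (e' (b, Ordinal k0)); rewrite /F /= he'.
  by case/(can_inj e'K).
congr pair => //; apply/ffunP => b; apply/permP => i.
have := FE (e' (b, i)); rewrite /F /= he' ie'.
by case/(can_inj e'K).
Qed.

Lemma liftsT_stab : P = [set: {perm B}] ->
  lifts = [set p : {perm T} | [forall x, forall y, (h (p x) == h (p y)) == (h x == h y)]].
Proof.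
move=> PT; apply/setP => p; rewrite !inE PT; apply/exists_inP/forallP.
  move=> [q _ /forallP pq] x; apply/forallP => y.
  by rewrite (eqP (pq x)) (eqP (pq y)) (inj_eq perm_inj).
move=> pp; have {}pp x y : (h (p x) == h (p y)) = (h x == h y).
  by have /forallP/(_ y)/eqP := pp x.
have surj b : exists x, h x == b.
  have : (0 < #|[set x | h x == b]|)%N by rewrite hk.
  by case/card_gt0P => x; rewrite inE; exists x.
pose s b := xchoose (surj b); have sP b : h (s b) = b by apply/eqP/(xchooseP (surj b)).
have q_inj : injective (fun b => h (p (s b))).
  by move=> b c /eqP; rewrite pp !sP => /eqP.
exists (perm q_inj) => //; apply/forallP => x; rewrite permE pp sP //.
Qed.

End Wreath.

Lemma card_mod_fiber M a N c : (M = a * N)%N -> (c < N)%N ->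
  #|[set i : 'I_M | i %% N == c]%N| = a.
Proof.
move=> -> cN; have N0 : (0 < N)%N by apply: leq_ltn_trans cN.
have kin (k : 'I_a) : (k * N + c < a * N)%N.
  have : (k.+1 * N <= a * N)%N by rewrite leq_mul2r ltn_ord orbT.
  by rewrite mulSn; lia.
rewrite -[RHS]card_ord -(card_imset _ (f := fun k => Ordinal (kin k))).
  apply: eq_card => i; rewrite inE; apply/eqP/imsetP => [ic|[k _ ->]]; last first.
    by rewrite /= modnMDl modn_small.
  have qa : (i %/ N < a)%N by rewrite ltn_divLR.
  exists (Ordinal qa) => //; apply/val_inj; rewrite /= [LHS](divn_eq i N) ic //.
by move=> k l [] /addIn /eqP; rewrite eqn_pmul2r // => /eqP /val_inj.
Qed.

(** * The number of representatives *)

Lemma index2_card n (U K : {set word n}) k0 : linear_set K -> linear_set U ->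
  index2 U K -> k0 \in K -> k0 \notin U -> #|K| = (2 * #|U|)%N.
Proof.
move=> linK linU [UK UU] k0K k0U; rewrite -(cardsID U K) (setIidPr UK) mul2n -addnn.
congr addn; rewrite -(card_imset (K :\: U) (@addrI _ k0)); congr #|pred_of_set _|.
apply/setP => x; apply/imsetP/idP => [[y]|xU]; first by rewrite inE => /andP[yU yK] ->; apply: UU.
exists (k0 + x); last by rewrite word_addKx.
rewrite inE (linear_add _ linK k0K) (subsetP UK) // andbT.
by rewrite addrC (linear_add _ linU).
Qed.

Section Stabilizers.
Variable m : nat.
Implicit Types (t : nat) (i j : 'I_(2 ^ m)) (x : word (2 ^ m)) (p : {perm 'I_(2 ^ m)}).

Lemma mem_U t x : (x \in U m t) = (x \in K m t) && (dot (hw m t) x == 0).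
Proof. by rewrite [LHS]inE. Qed.

Lemma card_cls t b : (t <= m)%N -> #|[set i | cls t i == b :> 'I_(2 ^ (m - t))]| = (2 ^ t)%N.
Proof.
move=> tm; rewrite -[RHS](card_mod_fiber (M := 2 ^ m) _ (ltn_ord b)); last first.
  by rewrite -expnD subnKC.
by apply: eq_card => i; rewrite !inE -val_eqE.
Qed.

Lemma perm_stab_K t : (t <= m)%N -> perm_stab (K m t) = lifts (cls t) setT.
Proof.
move=> tm; rewrite (liftsT_stab (pow2_gt0 t) (fun b => card_cls b tm) erefl).
by apply/setP => p; rewrite perm_stab_cker inE.
Qed.

Lemma card_perm_stab_K t : (t <= m)%N ->
  #|perm_stab (K m t)| = ((2 ^ t)`! ^ (2 ^ (m - t)) * (2 ^ (m - t))`!)%N.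
Proof.
move=> tm; rewrite perm_stab_K // (card_lifts _ (pow2_gt0 t)) => [|b]; last exact: card_cls.
by rewrite card_ord cardsT card_Sn.
Qed.

Lemma cls_surj t b : (t <= m)%N -> exists i, cls t i = b :> 'I_(2 ^ (m - t)).
Proof.
move=> tm; have : (0 < #|[set i | cls t i == b]|)%N by rewrite card_cls // pow2_gt0.
by case/card_gt0P => i; rewrite inE => /eqP; exists i.
Qed.

Lemma Aut_U_sub_Aut_L t : (0 < t < m)%N -> Aut_set (U m t) \subset Aut_set (L m t).
Proof.
move=> tm; have tm' : (0 < t <= m)%N by lia.
apply/subsetP => g /Aut_setP[gI gU]; rewrite -calA_L // /calA Omega_A //.
by apply/Aut_setP; split=> //; rewrite -Omega_isometry // gU.
Qed.

Lemma perm_stab_Aut (S : {set word (2 ^ m)}) p : linear_set S ->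
  (p \in perm_stab S) = (affine_perm 0 p \in Aut_set S).
Proof.
move=> linS; apply/perm_stabP/(Aut_linearP _ _ linS) => [pS|[]//].
by split=> //; case: linS.
Qed.

Lemma perm_stab_KP t p :
  reflect (forall i j, (cls t (p i) == cls t (p j)) = (cls t i == cls t j))
          (p \in perm_stab (K m t)).
Proof.
rewrite perm_stab_cker; apply: (iffP forallP) => [H i j|H i].
  by have /forallP/(_ j)/eqP := H i.
by apply/forallP => j; rewrite H.
Qed.

Lemma perm_stab_U_K t : (0 < t <= m)%N -> perm_stab (U m t) \subset perm_stab (K m t.-1).
Proof.
move=> tm; apply/subsetP => p pU; apply/perm_stab_KP => i j.
by rewrite -!U_unitw // perm_stab_unitw.
Qed.

(** A permutation respecting both partitions keeps or swaps the halves within each class of level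
    [t]. It thus changes [hw t] by a function constant on these classes, which vanishes on [K t]. *)
Lemma perm_stab_U t : (0 < t)%N -> (t.+1 < m)%N ->
  perm_stab (U m t) = perm_stab (K m t) :&: perm_stab (K m t.-1).
Proof.
move=> t0 tm; have tm' : (0 < t <= m)%N by lia. have tm1 : (0 < t < m)%N by lia.
apply/setP => p; rewrite in_setI; apply/idP/andP => [pU|[/[dup] pK /perm_stab_KP pt /perm_stab_KP pt']].
  split; last exact: subsetP (perm_stab_U_K tm') _ pU.
  rewrite perm_stab_Aut; last exact: K_linear.
  rewrite -L_K //; apply: (subsetP (Aut_U_sub_Aut_L tm1)).
  by rewrite -perm_stab_Aut //; apply: U_linear.
apply/perm_stabP => x; rewrite !mem_U (perm_stabP _ _ pK); apply: andb_id2l => xK.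
have : dot (col_perm p^-1 (hw m t) + hw m t) x = 0.
  apply: cker_dot xK => i j /eqP ij; rewrite !mxE.
  have [i' iE] : exists i', i = p i' by exists (p^-1%g i); rewrite permKV.
  have [j' jE] : exists j', j = p j' by exists (p^-1%g j); rewrite permKV.
  move: ij; rewrite iE jE !permK => ij; have := pt' i' j'.
  rewrite !clsS // -(pt i' j') ij /=.
  by case: (lohalf t i'); case: (lohalf t j'); case: (lohalf t (p i')); case: (lohalf t (p j')) => // _; apply/val_inj.
rewrite dotC dotDr !(dotC x) dot_col_perm.
by case: (F2_cases (dot (hw m t) x)) (F2_cases (dot (col_perm p^-1 (hw m t)) x)) => [] -> [] ->.
Qed.

(** An iterated wreath product: coordinates within the fine classes, the two fine classes within
    each coarse class, and the coarse classes among themselves. *)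
Lemma card_perm_stab_U t : (0 < t)%N -> (t.+1 < m)%N ->
  #|perm_stab (U m t)| = ((2 ^ t.-1)`! ^ (2 ^ (m - t)).*2
     * (2 ^ (2 ^ (m - t)) * (2 ^ (m - t))`!))%N.
Proof.
move=> t0 tm; have tm' : (0 < t <= m)%N by lia.
have tm1 : (t.-1 <= m)%N by lia. have tm2 : (t <= m)%N by lia.
pose g (c : 'I_(2 ^ (m - t.-1))) : 'I_(2 ^ (m - t)) := Ordinal (ltn_pmod c (pow2_gt0 (m - t))).
have gcls i : g (cls t.-1 i) = cls t i.
  by apply/val_inj; rewrite /= pow2_pred // modn_dvdm // -muln2 dvdn_mulr.
have gk b : #|[set c | g c == b]| = 2%N.
  rewrite -[RHS](card_mod_fiber (M := 2 ^ (m - t.-1)) _ (ltn_ord b)); last first.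
    by rewrite pow2_pred // mul2n.
  by apply: eq_card => c; rewrite !inE -val_eqE.
have -> : perm_stab (U m t) = lifts (cls t.-1) (lifts g setT).
  rewrite (liftsT_stab _ gk erefl) // perm_stab_U //; apply/setP => p; rewrite in_setI.
  apply/andP/idP => [[/perm_stab_KP pt]|].
    rewrite perm_stab_K // inE => /exists_inP[q _ /forallP pq].
    rewrite inE; apply/exists_inP; exists q; last exact/forallP.
    rewrite inE; apply/forallP => c; apply/forallP => d.
    have [i <-] := cls_surj c tm1; have [j <-] := cls_surj d tm1.
    by rewrite -(eqP (pq i)) -(eqP (pq j)) !gcls pt.
  rewrite inE => /exists_inP[q]; rewrite inE => /forallP qg /forallP pq; split.
    apply/perm_stab_KP => i j; rewrite -!gcls (eqP (pq i)) (eqP (pq j)).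
    by have /forallP/(_ (cls t.-1 j))/eqP := qg (cls t.-1 i).
  by rewrite perm_stab_K // inE; apply/exists_inP; exists q => //; apply/forallP.
rewrite (card_lifts _ (pow2_gt0 t.-1)) => [|b]; last exact: card_cls.
rewrite (card_lifts _ (isT : 0 < 2)%N gk) card_ord pow2_pred // card_ord cardsT card_Sn.
by [].
Qed.

(* With four classes, [U m m.-1] consists of the words that have the same sum
   on each class, so that any permutation of the classes preserves it. *)
Lemma perm_stab_U_top : (1 < m)%N -> perm_stab (U m m.-1) = perm_stab (K m m.-2).
Proof.
move=> m1; have tm : (0 < m.-1 <= m)%N by lia.
apply/eqP; rewrite eqEsubset perm_stab_U_K //; apply/subsetP => p pK.
pose csum i x := \sum_(l | cls m.-2 l == cls m.-2 i) x 0 l.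
have N2 : (2 ^ (m - m.-1) = 2)%N by have -> : (m - m.-1 = 1)%N by lia.
have lt2 (k : 'I_(2 ^ (m - m.-1))) : (k < 2)%N by rewrite -[X in (_ < X)%N]N2 ltn_ord.
have VE r i j : r \in V m m.-1 -> csum i r = csum j r.
  case/imsetP => v; rewrite inE even_wordE => /eqP v0 ->.
  pose z : 'I_(2 ^ (m - m.-1)) := Ordinal (pow2_gt0 _).
  have vz k : v 0 k = v 0 z.
    case: (eqVneq k z) => [->//|kz]; apply/eqP; rewrite eq_sym.
    have := v0; rewrite (bigD1 z) //= (bigD1 k) //= big1 => [|l /andP[]].
      rewrite addr0; by case: (F2_cases (v 0 z)) (F2_cases (v 0 k)) => [] -> [] ->.
    by move: kz; rewrite -!val_eqE /=; have := lt2 l; have := lt2 k; lia.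
  suff E l : csum l (@twice m m.-1 v) = v 0 z by rewrite !E.
  have lN : (l %% (2 ^ (m - m.-1)).*2 < (2 ^ (m - m.-1)).*2)%N by rewrite ltn_mod double_gt0 pow2_gt0.
  pose c : 'I_(2 ^ m) := Ordinal (leq_trans lN (leN2 tm)).
  have -> : csum l (@twice m m.-1 v) = csum c (@twice m m.-1 v).
    by rewrite /csum (_ : cls m.-2 c = cls m.-2 l) //; apply/val_inj; rewrite /= (pow2_pred tm) modn_mod.
  rewrite /csum (supp2_cls_pred tm) //; last exact: twice_supp.
  case: (ltnP c (2 ^ (m - m.-1))) => cN.
    by rewrite (@twice_lo m m.-1 _ _ (Ordinal cN)).
  have jN : (c - 2 ^ (m - m.-1) < 2 ^ (m - m.-1))%N by move: (lN) cN => /=; lia.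
  by rewrite (@twice_hi m m.-1 _ _ (Ordinal jN)) //= subnK.
(* [r1] has sum 1 on every class; adding it reduces the words with common class sum 1 to those with
   class sum 0. *)
have [r1 r1V r1n0] : exists2 r1, r1 \in V m m.-1 & r1 != 0.
  have /subsetPn[r rV] : ~~ (V m m.-1 \subset [set 0]).
    apply/negP => /subset_leq_card; by rewrite cards1 card_V // N2.
  by rewrite inE; exists r.
have csumK x : (forall i, csum i x = 0) -> x \in K m m.-2.
  move=> x0; apply/ckerP => c; have [|i <-] := cls_surj c; [by lia | exact: x0].
have Kcsum x i : x \in K m m.-2 -> csum i x = 0 by move/ckerP => x0; apply: x0.
have csumD i x y : csum i (x + y) = csum i x + csum i y by apply: sum_addw.
have csumU x : x \in U m m.-1 <-> forall i j, csum i x = csum j x.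
  split=> [xU i j|xE].
    have [r rV rxK] := U_decomp tm xU.
    have E l : csum l x = csum l r.
      by have := Kcsum _ l rxK; rewrite csumD => /eqP; case: (F2_cases (csum l x)) (F2_cases (csum l r)) => [] -> [] ->.
    by rewrite !E; apply: VE.
  pose i0 : 'I_(2 ^ m) := Ordinal (pow2_gt0 m).
  case: (F2_cases (csum i0 x)) => x0.
    by apply: (subsetP (K_pred_sub tm)); apply: csumK => i; rewrite (xE i i0).
  case: (F2_cases (csum i0 r1)) => r10.
    case/eqP: r1n0; apply: (V_cap_K tm r1V); apply: csumK => i.
    by rewrite (VE _ i i0).
  rewrite -(linear_add _ (U_linear m m.-1) (subsetP (V_sub_U tm) _ r1V)).
  apply: (subsetP (K_pred_sub tm)); apply: csumK => i.
  by rewrite csumD (xE i i0) (VE _ i i0) // x0 r10; apply/val_inj.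
have csump i x : csum i (col_perm p x) = csum (p i) x.
  rewrite [RHS](reindex_inj (@perm_inj _ p)); apply: eq_big => j; last by rewrite mxE.
  by have /perm_stab_KP -> := pK.
apply/perm_stabP => x; apply/idP/idP => /csumU H; apply/csumU => i j.
  by rewrite -(permKV p i) -(permKV p j) -!csump.
by rewrite !csump.
Qed.

End Stabilizers.

Section CardD.
Variables (m : nat) (D : nat -> {set {perm word (2 ^ m)}}).
Hypothesis repD : representatives D.

Lemma fact_pow2 t : (0 < t)%N ->
  ((2 ^ t)`! = 'C(2 ^ t, 2 ^ t %/ 2) * ((2 ^ t.-1)`! * (2 ^ t.-1)`!))%N.
Proof.
move=> t0; have -> : (2 ^ t %/ 2 = 2 ^ t.-1)%N by rewrite -{1}(prednK t0) expnS mulKn.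
have tE : (2 ^ t = 2 ^ t.-1 + 2 ^ t.-1)%N by rewrite addnn -mul2n -expnS prednK.
by rewrite -(@bin_fact (2 ^ t) (2 ^ t.-1)) ?tE ?leq_addr // addnK.
Qed.

(** The index of [Aut_set (U t)] in [Aut_set (K t)]: the factor 2 is the index of [U t] in [K t],
    the rest is the ratio of the two wreath products. *)
Lemma card_D t : (0 < t)%N -> (t.+1 < m)%N ->
  (#|D t| * 2 ^ (2 ^ (m - t)) = 2 * 'C(2 ^ t, 2 ^ t %/ 2) ^ (2 ^ (m - t)))%N.
Proof.
move=> t0 tm; have t1 : (0 < t < m)%N by lia. have tm' : (0 < t <= m)%N by lia.
have := reps_card (representatives_reps repD t1) (Aut_U_sub_Aut_L t1).
rewrite L_K // !card_Aut_linear; [|exact: K_linear|exact: U_linear].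
have [k0 k0K k0U] := not_index2_witness tm'.
rewrite (index2_card (K_linear m t) (U_linear m t) (U_index2 m t) k0K k0U).
rewrite card_perm_stab_U // card_perm_stab_K; last by lia.
rewrite (fact_pow2 t0); have := pow2_gt0 (m - t); set N := (2 ^ (m - t))%N => N0.
have U0 : (0 < #|U m t|)%N by apply/card_gt0P; exists 0; case: (U_linear m t).
have := fact_gt0 (2 ^ t.-1); move: ((2 ^ t.-1)`!) => f f0.
have := fact_gt0 N; move: (N`!) => F F0.
have -> : (f ^ N.*2 = (f * f) ^ N)%N by rewrite -mul2n expnM mulnn.
rewrite (expnMn 'C(_, _)); have : (0 < (f * f) ^ N)%N by rewrite expn_gt0 muln_gt0 f0.
move: ((f * f) ^ N)%N (2 ^ N)%N ('C(2 ^ t, 2 ^ t %/ 2) ^ N)%N #|U m t| U0 => g p q u u0 g0 E.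
apply/eqP; rewrite -(eqn_pmul2l (m := u * (g * F))) ?muln_gt0 ?u0 ?g0 ?F0 //.
by apply/eqP; nia.
Qed.

(** The stabilizer of four classes contributes 4! = 24, and [U m m.-1] has index 4 in the even
    words; the quotient is the constant 6. *)
Lemma card_D_top : (3 < m)%N -> (#|D m.-1| * (6 * ((2 ^ m %/ 4)`!) ^ 4) = (2 ^ m)`!)%N.
Proof.
move=> m3; have t1 : (0 < m.-1 < m)%N by lia. have tm' : (0 < m.-1 <= m)%N by lia.
have mm : (0 < m <= m)%N by lia.
have := reps_card (representatives_reps repD t1) (Aut_U_sub_Aut_L t1).
rewrite /L prednK ?eqxx; last by lia.
rewrite !card_Aut_linear; [|exact: K_linear|exact: U_linear].
have [k0 k0K k0U] := not_index2_witness tm'.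
have [k1 k1K k1U] := not_index2_witness mm.
rewrite (index2_card (K_linear m m) (U_linear m m) (U_index2 m m) k1K k1U) Um; last by lia.
rewrite (index2_card (K_linear m m.-1) (U_linear m m.-1) (U_index2 m m.-1) k0K k0U).
rewrite perm_stab_U_top ?card_perm_stab_K ?leq_pred //; [|by lia|by lia].
rewrite subnn expn0 expn1 muln1.
have -> : (m - m.-2 = 2)%N by lia.
have -> : (2 ^ m %/ 4 = 2 ^ m.-2)%N.
  by rewrite -{1}[m](_ : m.-2.+2 = m)%N; [rewrite !expnS mulnA mulKn | lia].
have U0 : (0 < #|U m m.-1|)%N by apply/card_gt0P; exists 0; case: (U_linear m m.-1).
move: ((2 ^ m.-2)`!) ((2 ^ m)`!) => f F; rewrite -[(2 ^ 2)%N]/4%N -[4`!]/24%N => E.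
apply/eqP; rewrite -(eqn_pmul2l (m := #|U m m.-1| * 4)) ?muln_gt0 ?U0 //; apply/eqP.
move: E; move: (f ^ 4)%N => f4; nia.
Qed.

End CardD.

(** * Closed forms *)

(** The exponents [2 ^ (m - s) - 1] add up to a geometric sum minus the number of factors; this is
    the origin of the logarithms in the closed forms. *)
Lemma prod_card_V m a : (0 < a <= m)%N ->
  (\prod_(a <= s < m) #|V m s| = 2 ^ (2 ^ (m - a).+1 - (m - a).+1 - 1))%N.
Proof.
move=> am; have [j jm] : exists j, m = (a + j)%N by exists (m - a)%N; lia.
elim: j a am jm => [|j IH] a am jm.
  by rewrite jm addn0 big_geq // subnn.
rewrite big_ltn; last by lia.
rewrite IH ?card_V; try lia.
have -> : (m - a.+1).+1 = (m - a)%N by lia.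
rewrite -expnD; congr (_ ^ _)%N; rewrite expnS.
have := ltn_expl (m - a) (isT : 1 < 2)%N; lia.
Qed.

Section ClosedForms.
Variables (R : realType) (m : nat) (D : nat -> {set {perm word (2 ^ m)}}).
Hypotheses (m4 : (4 <= m)%N) (repD : representatives D).

Lemma card_codes_prod T : (0 < T < m)%N -> #|codes D T| =
  (\prod_(1 <= t < T) #|colls D t.+1| ^ (\prod_(t.+2 <= s < T.+1) #|V m s|))%N.
Proof.
elim: T => // T IH Tm; case: T IH Tm => [_ _|T IH Tm].
  by rewrite big_geq //= cards1.
rewrite card_codes // ?IH; [|by lia..].
rewrite [RHS]big_nat_recr //= [in RHS](big_geq (leqnn _)) expn1 mulnC; congr muln.
have -> : forall F : nat -> nat, ((\prod_(1 <= t < T.+1) F t) ^ #|V m T.+2| =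
    \prod_(1 <= t < T.+1) F t ^ #|V m T.+2|)%N.
  move=> F; apply: (big_morph (fun x => x ^ _)%N) => [x y|]; [exact: expnMn | exact: exp1n].
apply: eq_big_nat => t tT; rewrite -expnM [in RHS]big_nat_recr //=; lia.
Qed.

Lemma K_LA_product : (K_LA D)%:R = count_product R D.
Proof.
rewrite card_K_LA //; last by lia.
rewrite natrM card_codes_prod; last by lia.
rewrite /count_product natr_prod; congr (_ * _); apply: eq_big_nat => t tm.
have -> : m.-1.+1 = m by lia.
rewrite natrX; congr (_ ^+ _).
rewrite -natrX -natrM -(@card_colls m D t) //; [|by lia..].
by rewrite natrD addrK.
Qed.

Lemma pow2_divn a b : (a <= b)%N -> (2 ^ b %/ 2 ^ a = 2 ^ (b - a))%N.
Proof. by move=> ab; rewrite -{1}(subnK ab) expnD mulnK ?pow2_gt0. Qed.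

Lemma card_D_closed t : (0 < t)%N -> (t.+1 < m)%N ->
  #|D t|%:R = 2 * 2 ^- (2 ^ (m - t)) * 'C(2 ^ t, 2 ^ t %/ 2)%:R ^+ (2 ^ (m - t)) :> R.
Proof.
move=> t0 tm; have := congr1 (fun k => k%:R : R) (card_D repD t0 tm).
rewrite !natrM !natrX => E; rewrite mulrAC -E mulfK //.
by rewrite expf_neq0 // pnatr_eq0.
Qed.

Lemma card_D_top_closed :
  #|D m.-1|%:R = (2 ^ m)`!%:R / (6 * ((2 ^ m %/ 4)`!)%:R ^+ 4) :> R.
Proof.
rewrite -(card_D_top repD m4) natrM natrM natrX mulfK //.
by rewrite mulf_neq0 ?pnatr_eq0 // expf_neq0 // pnatr_eq0 -lt0n fact_gt0.
Qed.

Lemma count_product_closed : count_product R D = count_closed R m.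
Proof.
rewrite /count_product /count_closed card_D_top_closed; congr (_ * _).
apply: eq_big_nat => t tm; have t0 : (0 < t)%N by lia. have tm' : (t.+1 < m)%N by lia.
rewrite -expnS !pow2_divn; [|by lia..].
rewrite card_D_closed // card_V; last by lia.
rewrite prod_card_V; last by lia.
have -> : (m - t.+2).+1 = (m - t.+1)%N by lia.
rewrite trunc_expnK //; congr (_ ^+ _); rewrite subn1; congr (_ - _).
have := pow2_gt0 (m - t.+1).
(* With [M] for [2 ^ (m - t.+1)], the subtracted term [2 * 2 ^- (2 M) * b * 2 ^ (M - 1)] collapses
   to [b * 2 ^- M]. *)
have -> : (2 ^ (m - t) = 2 ^ (m - t.+1) + 2 ^ (m - t.+1))%N.
  by rewrite addnn -mul2n -expnS; congr (_ ^ _)%N; lia.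
case: (2 ^ (m - t.+1))%N => // M _; move: ('C(_, _)%:R ^+ _) => b.
rewrite natrX exprD !exprS /=; have : 2 ^+ M != 0 :> R by rewrite expf_neq0 // pnatr_eq0.
by move: (2 ^+ M) => x x0; field.
Qed.

Lemma main_product_closed : main_product R D = main_closed R m.
Proof.
rewrite /main_product /main_closed card_D_top_closed; congr (_ * _).
apply: eq_big_nat => t tm; have t0 : (0 < t)%N by lia. have tm' : (t.+1 < m)%N by lia.
rewrite !pow2_divn; [|by lia..].
rewrite card_D_closed // prod_card_V; last by lia.
have -> : (m - t.+1).+1 = (m - t)%N by lia.
by rewrite trunc_expnK.
Qed.

End ClosedForms.

(** * Asymptotics *)

Lemma central_bin_ge j : (2 ^ j <= 'C(j.*2, j))%N.
Proof.
elim: j => // j IH; rewrite doubleS binS; have := binS j.*2 j.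
case: j IH => [|j] IH; first by [].
have := binS j.+1.*2 j; rewrite expnS; lia.
Qed.

Section Asymptotics.
Variables (m : nat) (D : nat -> {set {perm word (2 ^ m)}}).
Hypotheses (m5 : (5 <= m)%N) (repD : representatives D).

(** The central binomial coefficient is at least [2 ^ (k / 2)] for [k = 2 ^ t], and the power
    [n / k] of this bound is [2 ^ (n / 2)]. *)
Lemma card_D_ge t : (0 < t)%N -> (t.+1 < m)%N ->
  (2 ^ (1 + 2 ^ m.-1 - 2 ^ (m - t)) <= #|D t|)%N.
Proof.
move=> t0 tm; have E := card_D repD t0 tm.
have le : (2 ^ (m - t) <= 2 ^ m.-1)%N by rewrite leq_exp2l //; lia.
rewrite -(leq_pmul2r (pow2_gt0 (2 ^ (m - t)))) E -expnD subnK; last by lia.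
rewrite expnD leq_mul2l /=.
have -> : (2 ^ m.-1 = 2 ^ t.-1 * 2 ^ (m - t))%N.
  by rewrite -expnD; congr (_ ^ _)%N; lia.
rewrite expnM leq_exp2r ?pow2_gt0 //.
have -> : (2 ^ t %/ 2 = 2 ^ t.-1)%N by rewrite -{1}(prednK t0) expnS mulKn.
have -> : (2 ^ t = (2 ^ t.-1).*2)%N by rewrite -mul2n -expnS prednK.
exact: central_bin_ge.
Qed.

Lemma pow2_ge j : (j < 2 ^ j)%N. Proof. exact: ltn_expl. Qed.

(* The factor of index [t] loses at most the fraction [2 ^- (2 ^ (m - 2))] to
   the degenerate collections; this is false for [m = 4] and [t = 1]. *)
Lemma deg_bound t : (0 < t)%N -> (t.+1 < m)%N ->
  ((\prod_(t.+1 <= s < m) #|V m s|) * (#|D t| * 2 ^ (2 ^ (m - 2))) <= #|D t| ^ #|V m t.+1|)%N.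
Proof.
move=> t0 tm; rewrite prod_card_V ?card_V; try lia.
have -> : (m - t.+1).+1 = (m - t)%N by lia.
set y := (2 ^ (2 ^ (m - t.+1)).-1)%N; have y0 : (0 < y)%N by apply: pow2_gt0.
rewrite -(prednK y0) expnS mulnCA leq_mul2l; apply/orP; right.
have zE : (2 ^ m.-1 = (2 ^ (m - 2)).*2)%N by rewrite -mul2n -expnS; congr (_ ^ _)%N; lia.
have NE : (2 ^ (m - t) = (2 ^ (m - t.+1)).*2)%N.
  by rewrite -mul2n -expnS; congr (_ ^ _)%N; lia.
have z8 : (2 ^ 3 <= 2 ^ (m - 2))%N by rewrite leq_exp2l //; lia.
have M2 : (2 ^ 1 <= 2 ^ (m - t.+1))%N by rewrite leq_exp2l //; lia.
have mt : (2 <= m - t)%N by lia.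
have yM : (2 ^ (m - t.+1) <= y)%N.
  by rewrite /y -{1}(prednK (pow2_gt0 (m - t.+1))); apply: pow2_ge.
have y1 : (0 < y.-1)%N by move: M2 yM; rewrite expn1; lia.
apply: leq_trans (_ : (2 ^ (1 + 2 ^ m.-1 - 2 ^ (m - t))) ^ y.-1 <= _)%N; last first.
  by rewrite leq_exp2r ?card_D_ge //; lia.
rewrite -expnD -expnM leq_exp2l //.
rewrite zE NE; move: z8 M2; rewrite -[(2 ^ 3)%N]/8%N -[(2 ^ 1)%N]/2%N => z8 M2.
(* For [t >= 2] the exponent bounding [#|D t|] is at least [1 + 2 ^ (m - 2)]. For [t = 1] it is only
   1, and the estimate rests on the size of [V m 2] through [3 k + 1 <= 2 ^ (k - 1)] for
   [k >= 8]. *)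
case: (ltnP 1 t) => t1.
  have Mz : ((2 ^ (m - t.+1)).*2 <= 2 ^ (m - 2))%N by rewrite -NE leq_exp2l //; lia.
  clearbody y; move: (2 ^ (m - t.+1))%N (2 ^ (m - 2))%N yM z8 M2 Mz => M z yM z8 M2 Mz.
  apply: leq_trans (_ : ((1 + z) * y.-1)%N <= _)%N; last first.
    by apply: leq_mul => //; lia.
  have : (z * 1 <= z * y.-1)%N by apply: leq_mul => //; lia.
  nia.
have tE : t = 1%N by lia.
have -> : (2 ^ (m - t.+1) = 2 ^ (m - 2))%N by congr (_ ^ (_ - _))%N; lia.
rewrite addnK mul1n /y tE.
have P3 k : (8 <= k)%N -> (3 * k + 1 <= 2 ^ k.-1)%N.
  elim: k => // k IH; rewrite leq_eqVlt => /orP[/eqP <- //|k8].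
  have -> : (2 ^ k.+1.-1 = 2 * 2 ^ k.-1)%N by rewrite -expnS; congr (_ ^ _)%N; lia.
  by have := IH k8; lia.
have := P3 _ z8; lia.
Qed.

End Asymptotics.

(** * Bernoulli inequalities and the relative error *)

Section RealBounds.
Variable R : realType.
Implicit Types (a c e : R).

(** The Bernoulli inequality for the power of [c / a], cleared of denominators so that [a = 0] is
    allowed; where a factor [1 - k e] or [1 - e] is negative, the next lower bound is at most 0. *)
Lemma bernoulli a c e k : 0 <= c -> 0 <= e -> c <= a -> a * (1 - e) <= c ->
  a ^+ k * (1 - k%:R * e) <= c ^+ k.
Proof.
move=> c0 e0 ca ace; elim: k => [|k IH]; first by rewrite !expr0 mul0r subr0 mulr1.
have a0 : 0 <= a by apply: le_trans ca.
case: (lerP 0 (1 - k%:R * e)) => ke; last first.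
  apply: le_trans (exprn_ge0 _ c0); apply: mulr_ge0_le0; first exact: exprn_ge0.
  by rewrite -natr1 mulrDl mul1r; lra.
case: (lerP 0 (1 - e)) => e1; last first.
  apply: le_trans (exprn_ge0 _ c0); apply: mulr_ge0_le0; first exact: exprn_ge0.
  have : 0 <= k%:R * e by apply: mulr_ge0.
  by rewrite -natr1 mulrDl mul1r; lra.
rewrite !exprS; apply: le_trans (ler_pM _ _ ace IH); last 2 first.
- exact: mulr_ge0.
- by apply: mulr_ge0 => //; apply: exprn_ge0.
have -> : a * (1 - e) * (a ^+ k * (1 - k%:R * e)) =
  a * a ^+ k * (1 - k.+1%:R * e) + a * a ^+ k * (k%:R * e * e).
  by rewrite -natr1; ring.
by rewrite lerDl !mulr_ge0 // exprn_ge0.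
Qed.

Lemma prod_bernoulli (F G : nat -> R) e i j :
  (forall t, (i <= t < j)%N -> 0 <= G t <= F t /\ F t * (1 - e) <= G t) -> 0 <= e ->
  0 <= \prod_(i <= t < j) G t <= \prod_(i <= t < j) F t /\
  (\prod_(i <= t < j) F t) * (1 - (j - i)%:R * e) <= \prod_(i <= t < j) G t.
Proof.
move=> FG e0; case: (leqP j i) => [ji|ij].
  by rewrite !big_geq // (eqP ji) mul0r subr0 mulr1 ler01 lexx.
have [k jE] : exists k, j = (i + k)%N by exists (j - i)%N; lia.
rewrite {ij}jE addKn in FG *; elim: k FG => [|k IH] FG.
  by rewrite addn0 !big_geq // mul0r subr0 mulr1 ler01 lexx.
have [/andP[G0 GF] GE] : 0 <= \prod_(i <= t < i + k) G t <= \prod_(i <= t < i + k) F t /\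
    (\prod_(i <= t < i + k) F t) * (1 - k%:R * e) <= \prod_(i <= t < i + k) G t.
  by apply: IH => t tk; apply: FG; lia.
have [/andP[g0 gf] ge] : 0 <= G (i + k)%N <= F (i + k)%N /\ F (i + k)%N * (1 - e) <= G (i + k)%N.
  by apply: FG; lia.
rewrite addnS !big_nat_recr ?leq_addr //=.
move: (\prod_(i <= t < i + k) G t) (\prod_(i <= t < i + k) F t) G0 GF GE => P Q P0 PQ PE.
move: (G _) (F _) g0 gf ge => g f g0 gf ge.
have Q0 : 0 <= Q by apply: le_trans PQ. have f0 : 0 <= f by apply: le_trans gf.
split; first by rewrite mulr_ge0 //= ler_pM.
case: (lerP 0 (1 - k%:R * e)) => ke; last first.
  apply: le_trans (mulr_ge0 P0 g0); apply: mulr_ge0_le0; first exact: mulr_ge0.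
  by rewrite -natr1 mulrDl mul1r; lra.
case: (lerP 0 (1 - e)) => e1; last first.
  apply: le_trans (mulr_ge0 P0 g0); apply: mulr_ge0_le0; first exact: mulr_ge0.
  have : 0 <= k%:R * e by apply: mulr_ge0.
  by rewrite -natr1 mulrDl mul1r; lra.
apply: le_trans (ler_pM _ _ PE ge); [|exact: mulr_ge0..].
have -> : Q * (1 - k%:R * e) * (f * (1 - e)) =
  Q * f * (1 - k.+1%:R * e) + Q * f * (k%:R * e * e) by rewrite -natr1; ring.
by rewrite lerDl !mulr_ge0.
Qed.

(** Each of the [m - 2] factors loses at most the fraction [e], and [(m - 1) (m - 2) e <= 1]. *)
Lemma count_main_bound m (D : nat -> {set {perm word (2 ^ m)}}) :
  (5 <= m)%N -> representatives D ->
  `|count_product R D - main_product R D| <= m.-1%:R^-1 * `|main_product R D|.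
Proof.
move=> m5 repD; pose e : R := (2 ^+ (2 ^ (m - 2)))^-1.
have e0 : 0 <= e by rewrite invr_ge0 exprn_ge0 // ler0n.
pose MV t := (\prod_(t.+2 <= s < m) #|V m s|)%N.
have V0 s : (0 < s <= m)%N -> (0 < #|V m s|)%N by move=> sm; rewrite card_V // pow2_gt0.
pose G t : R := (#|D t|%:R ^+ #|V m t.+1| - #|D t|%:R * #|V m t.+1|%:R) ^+ MV t.
pose F t : R := #|D t|%:R ^+ (\prod_(t.+1 <= s < m) #|V m s|).
have FG t : (1 <= t < m.-1)%N -> 0 <= G t <= F t /\ F t * (1 - e) <= G t.
  move=> tm; have t0 : (0 < t)%N by lia. have tm' : (t.+1 < m)%N by lia.
  have FE : F t = (#|D t|%:R ^+ #|V m t.+1|) ^+ MV t.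
    by rewrite /F big_ltn // exprM.
  have c0 : 0 <= #|D t|%:R ^+ #|V m t.+1| - #|D t|%:R * #|V m t.+1|%:R :> R.
    rewrite -natrX -natrM subr_ge0 ler_nat -(card_colls repD t0 tm') leq_addl //.
  have MV0 : (0 < MV t)%N.
    by rewrite /MV prod_card_V ?pow2_gt0 //; lia.
  have ca : #|D t|%:R ^+ #|V m t.+1| - #|D t|%:R * #|V m t.+1|%:R <= #|D t|%:R ^+ #|V m t.+1| :> R.
    by rewrite lerBlDr lerDl mulr_ge0.
  split; first by rewrite /G FE exprn_ge0 //= lerXn2r // nnegrE // (le_trans c0).
  have MVR0 : 0 < (MV t)%:R :> R by rewrite ltr0n.
  (* The factor is a power with exponent [MV t], so its base may lose only the fraction [e / MV t],
     which is what [deg_bound] provides. *)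
  have := @bernoulli _ _ (e / (MV t)%:R) (MV t) c0 _ ca.
  have -> : (MV t)%:R * (e / (MV t)%:R) = e by rewrite mulrC divfK ?gt_eqF.
  rewrite -FE; apply; first by rewrite divr_ge0.
  have := deg_bound m5 repD t0 tm'; rewrite big_ltn // -/(MV t).
  rewrite -(ler_nat R) !natrM !natrX => H.
  rewrite mulrBr mulr1 lerD2l lerN2 /e mulrA.
  rewrite ler_pdivlMr // ler_pdivlMr ?exprn_gt0 // ?ltr0n //.
  by apply: le_trans H; rewrite le_eqVlt; apply/orP; left; apply/eqP; ring.
have [/andP[G0 GF] GE] := prod_bernoulli FG e0.
rewrite /count_product /main_product -/(MV _).
rewrite -mulrBr !normrM mulrCA; apply: ler_wpM2l; first exact: normr_ge0.
have F0 := le_trans G0 GF.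
rewrite -[\prod_(1 <= t < m.-1) (_ - _) ^+ _]/(\prod_(1 <= t < m.-1) G t).
rewrite -[\prod_(1 <= t < m.-1) _ ^+ (\prod_(t.+1 <= s < m) _)]/(\prod_(1 <= t < m.-1) F t).
rewrite distrC (ger0_norm F0) ger0_norm; last by rewrite subr_ge0.
apply: le_trans (_ : (\prod_(1 <= t < m.-1) F t) * ((m.-1 - 1)%:R * e) <= _).
  by move: GE; rewrite mulrBr mulr1; lra.
rewrite mulrC; apply: ler_wpM2r => //.
rewrite /e ler_pdivrMr ?exprn_gt0 ?ltr0n // mulrC ler_pdivlMr ?ltr0n; last by lia.
rewrite -natrX -natrM ler_nat.
have j1 := pow2_ge (m - 2).
have j2 := pow2_ge (2 ^ (m - 2)).
(* Both [m - 1] and [m - 2] are at most [2 ^ (m - 2)], so their product is at most [1 / e]. *)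
have : ((2 ^ (m - 2)) * 2 ^ (m - 2) <= 2 ^ (2 ^ (m - 2)))%N.
  rewrite -expnD leq_exp2l //.
  have -> : (2 ^ (m - 2) = 2 * 2 ^ (m - 3))%N by rewrite -expnS; congr (_ ^ _)%N; lia.
  by have := pow2_ge (m - 3); lia.
nia.
Qed.

End RealBounds.

(* The exact count together with the asymptotic equivalence *)
From mathcomp Require Import functions topology normedtype landau.
Import numFieldNormedType.Exports.
Unset Implicit Arguments.
Local Open Scope classical_set_scope.
Local Open Scope ring_scope.

Theorem theorem1 (R : realType) :
  (forall (m : nat) (D : nat -> {set {perm word (2 ^ m)}}),
     (4 <= m)%N -> representatives D ->
     [/\ forall g h, is_family D g -> is_family D h -> C g = C h ->
           forall t rs, (2 <= t <= m)%N -> is_index t rs -> g rs = h rs,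
         (K_LA D)%:R = count_product R D,
         count_product R D = count_closed R m &
         main_product R D = main_closed R m])
  /\
  (forall D : forall m : nat, nat -> {set {perm word (2 ^ m)}},
     (forall m, (4 <= m)%N -> representatives (D m)) ->
     (fun m : nat => (K_LA (D m))%:R : R^o) ~_\oo
     (fun m : nat => main_product R (D m) : R^o)).
Proof.
split=> [m D m4 repD|D repD].
  split; [|exact: K_LA_product|exact: count_product_closed|exact: main_product_closed].
  by apply: family_unique => //; apply: leq_trans m4.
apply/eqaddoP => eps eps0; near=> m.
have m5 : (5 <= m)%N by near: m; exact: nbhs_infty_ge.
have m4 : (4 <= m)%N by apply: ltnW.
rewrite !fctE [X in `|X - _|](K_LA_product R m4 (repD m m4)).
apply: le_trans (count_main_bound R m5 (repD m m4)) _.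
apply: ler_wpM2r; first exact: normr_ge0.
rewrite invf_ple ?posrE ?ltr0n //; last by lia.
(* The strict bound leaves room for the predecessor: the relative error is [1 / (m - 1)], and
   [m - 1] still exceeds [1 / eps]. *)
have : (Num.Def.archi_bound eps^-1 < m)%N by near: m; exact: nbhs_infty_gt.
move=> mb; apply: ltW; apply: lt_le_trans (archi_boundP _) _; first by rewrite invr_ge0 ltW.
by rewrite ler_nat -ltnS prednK // (leq_trans _ m4).
Unshelve. all: by end_near.
Qed.
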